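(* Let $p>1$ and $F(u)=\frac{1}{2p}|u^2-1|^p$. Let $N\in\mathbb{N}$, let $v:[a,b]\to\{-1,1\}$ be a piecewise constant function with exactly $N$ jumps, located at $a<h_1<h_2<\dots<h_N<b$, let $r>0$ satisfy $h_i+r<h_{i+1}-r$ for $i=1,\dots,N-1$, $a\le h_1-r$ and $h_N+r\le b$, and fix $A\in(0,r\sqrt2\,\lambda_p)$. Then there exist $\varepsilon_0,C,\delta>0$ (depending only on $p$, $v$ and $A$) such that if $u\in H^1(a,b)$ satisfies $$\|u-v\|_{L^1}\le\delta,$$ then for any $\varepsilon\in(0,\varepsilon_0)$, $$E_\varepsilon[u]\ge Nc_p-C\exp(-Ap/2\varepsilon).$$
   Context: $[a,b]$ is a fixed bounded interval and $L^1=L^1(a,b)$. The renormalized energy is $$E_\varepsilon[u]=\int_a^b\left[\frac{\varepsilon^{p-1}|u_x|^p}{p}+\frac{F(u)}{\varepsilon}\right]dx$$ (equal to $+\infty$ if the integral diverges). The constants are $$c_p=\left(\frac{p}{p-1}\right)^{\frac{p-1}{p}}\int_{-1}^{1}F(s)^{\frac{p-1}{p}}\,ds,\qquad \lambda_p=2^{1-\frac1p}(p-1)^{-\frac1p}.$$ *)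

(* Defs.v *)
From HB Require Import structures.
From mathcomp Require Import all_boot all_order all_algebra.
From mathcomp Require Import all_classical all_reals all_analysis.

Set Implicit Arguments.
Unset Strict Implicit.
Unset Printing Implicit Defensive.

Import Order.TTheory GRing.Theory Num.Theory.
Import numFieldNormedType.Exports.

Local Open Scope classical_set_scope.
Local Open Scope ring_scope.

Section Definitions.
Context {R : realType}.
Local Notation mu := (@lebesgue_measure R).
Implicit Types (a b p eps : R) (u v g phi : R -> R).

(* Functions on (a,b) are represented by functions R -> R whose values outside
   `]a, b[ are irrelevant. *)

(* C^1_c(a,b); its elements are extended by 0 to the whole line. *)
Definition test_function a b phi : Prop :=
  [/\ forall x, derivable phi x 1,
      continuous (derive1 phi),
      compact (closure [set x | phi x != 0]) &
      closure [set x | phi x != 0] `<=` `]a, b[ ].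

(* Weak derivatives are tested against C^1_c(a,b), as in H. Brezis, "Functional
   Analysis, Sobolev Spaces and Partial Differential Equations", Section 8.2. *)
Definition is_weak_derivative a b u g : Prop :=
  [/\ locally_integrable `]a, b[ u,
      locally_integrable `]a, b[ g &
      forall phi, test_function a b phi ->
        Rintegral mu `]a, b[ (fun x => u x * derive1 phi x) =
        - Rintegral mu `]a, b[ (fun x => g x * phi x)].

(* A chosen representative of the weak derivative, which is unique almost
   everywhere when it exists (the default value 0 is used otherwise). *)
Definition weak_derivative a b u : R -> R :=
  xget (cst 0) [set g | is_weak_derivative a b u g].

Definition L2 a b u : Prop :=
  measurable_fun `]a, b[ u /\
  mu.-integrable `]a, b[ (fun x => (u x ^+ 2)%:E).

Definition H1 a b u : Prop :=
  L2 a b u /\ exists2 g, L2 a b g & is_weak_derivative a b u g.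

Definition L1_distance a b u v : \bar R :=
  (\int[mu]_(x in `]a, b[) `|u x - v x|%:E)%E.

Definition potential p (s : R) : R := (2 * p)^-1 * (`|s ^+ 2 - 1| `^ p).

(* The integrand is nonnegative, so this is +oo if the integral diverges. *)
Definition energy p a b eps u : \bar R :=
  (\int[mu]_(x in `]a, b[)
     ((eps `^ (p - 1)) * (`|weak_derivative a b u x| `^ p) / p
      + potential p (u x) / eps)%:E)%E.

Definition c_ p : R :=
  ((p / (p - 1)) `^ ((p - 1) / p)) *
  Rintegral mu `[-1, 1] (fun s => potential p s `^ ((p - 1) / p)).

Definition lambda_ p : R := (2 `^ (1 - p^-1)) * ((p - 1) `^ (- p^-1)).

(* v : [a,b] -> {-1,1} is piecewise constant and its jumps are exactly the N
   points h_1 < ... < h_N of (a,b), which are indexed here from 0.  A jump is a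
   point with distinct one-sided limits; the value of v there is not prescribed
   and can be either -1 or 1. *)
Definition piecewise_constant_with_jumps a b (N : nat) (h : 'I_N -> R) v :
    Prop :=
  [/\ forall x, x \in `[a, b] -> v x = -1 \/ v x = 1,
      forall i, a < h i < b,
      forall i j : 'I_N, (i < j)%N -> h i < h j,
      forall x y, a <= x -> x <= y -> y <= b ->
        (forall i, ~~ (x <= h i <= y)) -> v x = v y &
      forall i, exists l r : R,
        [/\ v x @[x --> (h i)^'-] --> l, v x @[x --> (h i)^'+] --> r & l <> r]].

End Definitions.

(* Main.v *)
Require Import Defs.
From HB Require Import structures.
From mathcomp Require Import all_boot all_order all_algebra.
From mathcomp Require Import all_classical all_reals all_analysis.
From mathcomp Require Import measurable_realfun ring lra.

Set Implicit Arguments.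
Unset Strict Implicit.
Unset Printing Implicit Defensive.

Import Order.TTheory GRing.Theory Num.Theory.
Import numFieldNormedType.Exports.

Local Open Scope classical_set_scope.
Local Open Scope ring_scope.

(** Each jump of v costs almost c_p.  Put G = lambda |u^2 - 1| / 2 and
    pc = p / (p - 1).  The potential is G^p / pc, so Young's inequality bounds the
    energy density from below by G^(p-1) |u'| ([density_ge_slope]).  Integrating, the
    energy of a segment is at least the variation over it of [action], the primitive
    of G^(p-1) on [-1, 1], and the total variation of [action] is c_p ([action1]).

    If u is L1-close to v, then u is close to -1 on one side of each jump and close
    to 1 on the other side, at points very near the jump.  What may be missing from
    c_p is the action between the values reached and the wells.  Consider the right
    half of the window of radius r around the jump, and let z be the least distance
    of u from 1 there.  The missing action is at most lambda^(p-1) z^p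
    ([action_tail]), which is harmless if z <= exp (- A / (2 eps)).  It is also
    harmless if u dips below 3/4 ([action_dip]).  In the remaining case
    u has stayed away from the well for the rescaled time r / eps, and Young's
    inequality with the slope G^(p-1) was wasteful: with the slope
    G^(p-1) - kappa / (1 - u) and kappa proportional to z^p, an amount of about
    kappa lambda of the potential is left over per unit of time
    ([barrier_density]).  The lowered slope loses kappa ln (1 / z), at most
    kappa A / (2 eps), while the potential left over amounts to about
    kappa lambda r / eps.  As A / 2 < r lambda / sqrt 2, the gain exceeds the loss by
    a multiple of kappa / eps, hence also the missing action once eps is small
    ([half_window]).  The gap between 1 / sqrt 2 and 1 leaves room for crude
    constants: those used below multiply to 105/128 * 7/8 > 5/7 > 1 / sqrt 2.

    The windows are disjoint, so the estimates add up.  To apply calculus to a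
    function that only has a weak derivative, u is replaced by a continuous
    representative whose increments are integrals of the weak derivative
    ([weak_derivative_representative]), and the chain rule is needed only as an
    inequality ([chain_inequality]). *)

(** * Smooth approximations of indicator functions *)

Section Tent.
Context {R : realType}.
Implicit Types s t x : R.

Definition pos_part t := Num.max t 0.

(** Its derivative is [pos_part], so second differences of [half_sq] are C^1
    functions that interpolate between 0 and 1. *)
Definition half_sq t := pos_part t ^+ 2 / 2.

Lemma half_sq_taylor t e : `|half_sq (t + e) - half_sq t - e * pos_part t| <= e ^+ 2.
Proof.
rewrite /half_sq /pos_part.
case: (leP (t + e) 0) => te; case: (leP t 0) => t0; rewrite ?expr0n /=.
- by rewrite mul0r subrr sub0r mulr0 normrN normr0 sqr_ge0.
- rewrite ler_norml; apply/andP; split; nra.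
- rewrite ler_norml; apply/andP; split; nra.
- rewrite ler_norml; apply/andP; split; nra.
Qed.

Lemma is_derive_half_sq t : is_derive t (1 : R) half_sq (pos_part t).
Proof.
suff H : h^-1 *: (half_sq (h *: 1 + t) - half_sq t) @[h --> (0:R)^'] --> pos_part t.
  apply: DeriveDef; first by apply/cvg_ex; exists (pos_part t).
  exact: cvg_lim.
apply/cvgrPdist_le => e e0; near=> h.
have h0 : h != 0 by near: h; exact: nbhs_dnbhs_neq.
have he : `|h| <= e by near: h; apply: dnbhs0_le.
have -> : pos_part t - h^-1 *: (half_sq (h *: 1 + t) - half_sq t) =
    - (h^-1 * (half_sq (t + h) - half_sq t - h * pos_part t)).
  rewrite /GRing.scale /= mulr1 [h + t]addrC.
  by field.
rewrite normrN normrM normfV ler_pdivrMl ?normr_gt0//.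
apply: le_trans (half_sq_taylor _ _) _.
by rewrite -(real_normK (num_real h)) expr2 ler_wpM2l.
Unshelve. all: by end_near. Qed.

Lemma continuous_pos_part : continuous pos_part.
Proof.
move=> t; apply: (@continuous_comp _ _ _ id (fun x => Num.max x 0)) => //.
exact: (@continuous_max _ _ id (cst 0) t) (cvg_id) (cvg_cst _).
Qed.

(** [tent x s] is the hat of height 1/s and mass 1 supported in the segment
    [x - s, x + s], and [ramp x s] is its primitive that vanishes on the left.
    Both are second differences with step s, of [pos_part] and of [half_sq]. *)
Definition tent x s t :=
  s ^- 2 * (pos_part (t - x + s) - 2 * pos_part (t - x) + pos_part (t - x - s)).

Definition ramp x s t :=
  s ^- 2 * (half_sq (t - x + s) - 2 * half_sq (t - x) + half_sq (t - x - s)).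

Lemma is_derive_ramp x s t : is_derive t (1:R) (ramp x s) (tent x s t).
Proof.
have shift c : is_derive t (1:R) (fun t => half_sq (t + c)) (pos_part (t + c)).
  have := @is_derive1_comp _ half_sq (fun t => t + c) t (pos_part (t+c)) 1
    (is_derive_half_sq _) _.
  rewrite mulr1; apply.
  by apply: is_derive_eq; rewrite addr0.
have H1 := shift (- x + s). have H2 := shift (- x). have H3 := shift (- x - s).
rewrite /ramp /tent.
have -> : (fun t => s ^- 2 * (half_sq (t - x + s) - 2 * half_sq (t - x) + half_sq (t - x - s)))
  = (s ^- 2 *: ((fun t => half_sq (t + (- x + s))) -
     2 *: (fun t => half_sq (t + - x)) + (fun t => half_sq (t + (- x - s))))).
  by apply/funext => z; rewrite !fctE !addrA.
by apply: is_derive_eq; rewrite /GRing.scale/= !addrA.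
Qed.

Lemma continuous_tent x s : continuous (tent x s).
Proof.
have K c : continuous (fun t => pos_part (t + c)).
  move=> t; apply: (@continuous_comp _ _ _ (fun t => t + c) pos_part).
    by apply: cvgD => //; exact: cvg_cst.
  exact: continuous_pos_part.
have -> : tent x s = (fun t => s ^- 2 * (pos_part (t + (- x + s)) -
    2 * pos_part (t + (- x)) + pos_part (t + (- x - s)))).
  by apply/funext => t; rewrite /tent !addrA.
move=> t; apply: cvgM; first exact: cvg_cst.
apply: cvgD; last exact: K.
apply: cvgB; first exact: K.
by apply: cvgM; [exact: cvg_cst|exact: K].
Qed.

Lemma tent_ge0 x s t : 0 < s -> 0 <= tent x s t.
Proof.
move=> s0; apply: mulr_ge0; first by rewrite invr_ge0 exprn_ge0// ltW.
rewrite /pos_part; case: (leP (t - x + s) 0); case: (leP (t - x) 0); case: (leP (t - x - s) 0); lra.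
Qed.

Lemma tent_le x s t : 0 < s -> tent x s t <= s^-1.
Proof.
move=> s0; rewrite /tent mulrC ler_pdivrMr ?exprn_gt0// expr2 mulrA mulVf ?gt_eqF// mul1r.
rewrite /pos_part; case: (leP (t - x + s) 0); case: (leP (t - x) 0); case: (leP (t - x - s) 0); lra.
Qed.

Lemma tent_out x s t : 0 < s -> s <= `|t - x| -> tent x s t = 0.
Proof.
move=> s0; rewrite /tent ler_normr => /orP H.
suff -> : pos_part (t - x + s) - 2 * pos_part (t - x) + pos_part (t - x - s) = 0.
  by rewrite mulr0.
rewrite /pos_part; case: (leP (t - x + s) 0); case: (leP (t - x) 0); case: (leP (t - x - s) 0); case: H; lra.
Qed.

Lemma ramp_left x s t : 0 < s -> t <= x - s -> ramp x s t = 0.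
Proof.
move=> s0 H; rewrite /ramp /half_sq /pos_part.
rewrite !max_r; [|lra..].
by rewrite expr0n /= !mul0r mulr0 subr0 addr0 mulr0.
Qed.

Lemma ramp_right x s t : 0 < s -> x + s <= t -> ramp x s t = 1.
Proof.
move=> s0 H; rewrite /ramp /half_sq /pos_part.
rewrite !max_l; [|lra..].
by field; rewrite gt_eqF.
Qed.

Lemma ramp_ge0 x s t : 0 < s -> 0 <= ramp x s t.
Proof.
move=> s0; apply: mulr_ge0; first by rewrite invr_ge0 exprn_ge0// ltW.
rewrite /half_sq /pos_part; case: (leP (t - x + s) 0) => h1; case: (leP (t - x) 0) => h2; case: (leP (t - x - s) 0) => h3; nra.
Qed.

Lemma ramp_le1 x s t : 0 < s -> ramp x s t <= 1.
Proof.
move=> s0; rewrite /ramp mulrC ler_pdivrMr ?exprn_gt0// mul1r.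
rewrite /half_sq /pos_part; case: (leP (t - x + s) 0) => h1; case: (leP (t - x) 0) => h2; case: (leP (t - x - s) 0) => h3; nra.
Qed.

Lemma continuous_ramp x s : continuous (ramp x s).
Proof.
move=> t; apply: differentiable_continuous; apply/derivable1_diffP.
by have [] := is_derive_ramp x s t.
Qed.

End Tent.

Section WeakDerivative.
Context {R : realType}.
Local Notation mu := (@lebesgue_measure R).
Implicit Types (f g u k : R -> R) (s t x y : R).

Lemma integrable_mul_bounded f k (M : R) :
  mu.-integrable setT (EFin \o f) -> continuous k -> (forall t, `|k t| <= M) ->
  mu.-integrable setT (EFin \o (fun t => f t * k t)).
Proof.
move=> fi kc kM.
have -> : EFin \o (fun t => f t * k t) = ((EFin \o f) \* (EFin \o k))%E.
  by apply/funext => t /=; rewrite EFinM.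
apply: integrableMl => //.
- exact: continuous_measurable_fun.
- exists M; split; first exact: num_real.
  by move=> z Mz t _; apply: le_trans (kM t) (ltW Mz).
Qed.

Lemma norm_tent x s t : 0 < s -> `|tent x s t| <= s^-1.
Proof. by move=> s0; rewrite ger0_norm ?tent_ge0// tent_le. Qed.

Lemma norm_ramp x s t : 0 < s -> `|ramp x s t| <= 1.
Proof. by move=> s0; rewrite ger0_norm ?ramp_ge0// ramp_le1. Qed.

Lemma integrable_tent x s (D : set R) : 0 < s -> compact D ->
  mu.-integrable D (EFin \o tent x s).
Proof.
move=> s0 cD; apply: continuous_compact_integrable => //.
by apply: continuous_subspaceT; exact: continuous_tent.
Qed.

Lemma integral_tent x s : 0 < s -> \int[mu]_(t in ball x s) tent x s t = 1.
Proof.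
move=> s0; rewrite ball_itv.
have xs : x - s < x + s by lra.
have ti : mu.-integrable `[x - s, x + s] (EFin \o tent x s).
  by apply: integrable_tent => //; exact: segment_compact.
rewrite Rintegral_itv_bndo_bndc; last first.
  by apply: integrableS ti => //; apply: subset_itv; rewrite bnd_simp.
rewrite Rintegral_itv_obnd_cbnd; last first.
  by apply: integrableS ti => //; apply: subset_itv; rewrite bnd_simp.
rewrite /Rintegral (@continuous_FTC2 _ _ (ramp x s))//.
- by rewrite (@ramp_left _ x s (x - s))// (@ramp_right _ x s (x + s))// -EFinB subr0.
- by apply: continuous_subspaceT; exact: continuous_tent.
- split.
  + by move=> t _; have [] := is_derive_ramp x s t.
  + apply: cvg_at_right_filter; exact: continuous_ramp.
  + apply: cvg_at_left_filter; exact: continuous_ramp.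
- by move=> t _; rewrite derive1E; have [] := is_derive_ramp x s t.
Qed.

(** The tent has mass 1 and is at most 1/s, so the error is at most 1/s times the
    integral of |f - f x| over the ball of radius s, that is, twice the average
    whose limit is 0 at a Lebesgue point. *)
Lemma tent_approx f x : mu.-integrable setT (EFin \o f) -> lebesgue_pt f x ->
  forall e, 0 < e -> \forall s \near 0^'+,
    `|\int[mu]_t (f t * tent x s t) - f x| <= e.
Proof.
move=> fi fx e e0.
have : \forall s \near (0:R)^'+, (davg f x s < (e / 2)%:E)%E.
  move: fx => /(_ [set y | y < (e/2)%:E]%E); apply.
  by apply: (@open_nbhs_nbhs) ; split; [exact: open_ereal_lt_ereal|rewrite /= lte_fin divr_gt0].
move=> davgH; near=> s.
have s0 : 0 < s by near: s; exact: nbhs_right_gt.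
have : (davg f x s < (e / 2)%:E)%E by near: s; exact: davgH.
rewrite /davg /iavg (lebesgue_measure_ball _ (ltW s0)) inver gt_eqF ?pmulrn_lgt0//.
have mB : measurable (ball x s : set (measurableTypeR R)) by exact: measurable_ball.
have fiB : mu.-integrable (ball x s) (EFin \o f) by apply: integrableS fi.
have ciB (c : R) : mu.-integrable (ball x s) (EFin \o cst c).
  apply: measurable_bounded_integrable => //.
  - by have := lebesgue_measure_ball x (ltW s0); rewrite /= => ->; rewrite ltry.
  - by exists `|c|; split; [exact: num_real|move=> z /ltW cz t _].
have fciB : mu.-integrable (ball x s) (EFin \o (fun t => f t - f x)).
  have -> : EFin \o (fun t => f t - f x) = ((EFin \o f) \- (EFin \o cst (f x)))%E.
    by apply/funext => t /=; rewrite EFinB.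
  exact: integrableB.
have tB : mu.-integrable (ball x s) (EFin \o (tent x s)).
  apply: integrableS (_ : mu.-integrable `[x - s, x + s] _) => //.
    by rewrite ball_itv; apply: subset_itv; rewrite bnd_simp.
  by apply: integrable_tent => //; exact: segment_compact.
have tm : measurable_fun (ball x s) (tent x s).
  by apply: measurable_funTS; apply: continuous_measurable_fun; exact: continuous_tent.
have fctB : mu.-integrable (ball x s) (EFin \o (fun t => (f t - f x) * tent x s t)).
  have -> : EFin \o (fun t => (f t - f x) * tent x s t) =
     ((EFin \o (fun t => f t - f x)%R) \* (EFin \o tent x s))%E.
    by apply/funext => t /=; rewrite EFinM.
  apply: integrableMl => //; exists s^-1; split; first exact: num_real.
  by move=> z Mz t _; apply: le_trans (norm_tent _ _ s0) (ltW Mz).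
set J := (\int[mu]_(y in ball x s) `|(f y - f x)|).
have -> : (\int[mu]_(y in ball x s) `|((center (f x) \o f) y)%:E| = J%:E)%E.
  rewrite /J /Rintegral fineK//.
  exact: (integrable_fin_num mB (integrable_abse fciB)).
rewrite -EFinM lte_fin ltr_pdivrMl ?pmulrn_lgt0// => Jlt.
have -> : \int[mu]_t (f t * tent x s t) = \int[mu]_(t in ball x s) (f t * tent x s t).
  rewrite [RHS]Rintegral_mkcond; congr (Rintegral _ _ _).
  apply/funext => t; rewrite patchE; case: ifPn => //.
  rewrite notin_setE ball_itv /= in_itv/= => /negP H.
  rewrite tent_out ?mulr0// leNgt; apply: contra H.
  by rewrite ltr_norml => /andP[]; lra.
have -> : \int[mu]_(t in ball x s) (f t * tent x s t) - f x =
   \int[mu]_(t in ball x s) ((f t - f x) * tent x s t).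
  rewrite -[X in _ - X]mulr1 -(integral_tent x s0) -RintegralZl// -RintegralB//.
  - by apply: eq_Rintegral => t _; rewrite mulrBl.
  - have := integrableS measurableT mB (@subsetT _ _) (integrable_mul_bounded fi
        (@continuous_tent _ x s) (fun t => norm_tent x t s0)).
    exact.
  - exact: (integrableZl mB (f x) tB).
apply: le_trans (le_normr_Rintegral mB fctB) _.
apply: (@le_trans _ _ (\int[mu]_(t in ball x s) (s^-1 * `|f t - f x|))).
  apply: le_Rintegral => //.
  - exact: integrable_abse fctB.
  - exact: (integrableZl mB s^-1 (integrable_abse fciB)).
  - by move=> t _; rewrite normrM mulrC ler_wpM2r// norm_tent.
rewrite RintegralZl//; last exact: integrable_abse fciB.
rewrite -/J ler_pdivrMl//.
by apply: le_trans (ltW Jlt) _; rewrite -mulr_natl; lra.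
Unshelve. all: by end_near. Qed.

(** The ramp differs from the indicator of [x, +oo[ only within distance s of x,
    and by at most 1 there; the integral of |f| over such a short segment is small. *)
Lemma ramp_approx f x : mu.-integrable setT (EFin \o f) ->
  forall e, 0 < e -> \forall s \near 0^'+,
    `|\int[mu]_t (f t * ramp x s t) - \int[mu]_(t in `[x, +oo[) f t| <= e.
Proof.
move=> fi e e0.
have [d [d0 dH]] := integral_normr_continuous fi e0.
near=> s.
have s0 : 0 < s by near: s; exact: nbhs_right_gt.
have sd : s < d / 2 by near: s; apply: nbhs_right_lt; rewrite divr_gt0.
have i1 : mu.-integrable setT (EFin \o (fun t => f t * ramp x s t)).
  apply: (integrable_mul_bounded fi (@continuous_ramp _ x s) (fun t => norm_ramp x t s0)).
have i2 : mu.-integrable setT (EFin \o (f \_ `[x, +oo[)).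
  by rewrite -restrict_EFin; apply/integrable_restrict => //=; rewrite setTI; apply: integrableS fi.
have mB : measurable (ball x s : set (measurableTypeR R)) by exact: measurable_ball.
rewrite [X in _ - X]Rintegral_mkcond -RintegralB//.
have i3 : mu.-integrable setT (EFin \o (fun t => f t * ramp x s t - (f \_ `[x, +oo[) t)).
  have -> : EFin \o (fun t => f t * ramp x s t - (f \_ `[x, +oo[) t) =
    ((EFin \o (fun t => f t * ramp x s t)%R) \- (EFin \o (f \_ `[x, +oo[)))%E.
    by apply/funext => t /=; rewrite EFinB.
  exact: integrableB.
apply: le_trans (le_normr_Rintegral measurableT i3) _.
have : \int[mu]_(t in `[x - s, x + s]) `|f t| < e.
  have md : (mu `[(x - s)%R, (x + s)%R] < d%:E)%E.
    rewrite lebesgue_measure_itv/= lte_fin ifT; last lra.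
    by rewrite -EFinD lte_fin; lra.
  exact: dH (measurable_itv _) md.
(* Outside [x - s, x + s] the ramp equals the indicator. *)
move=> /ltW; apply: le_trans; rewrite [leRHS]Rintegral_mkcond.
apply: le_Rintegral => //.
- exact: integrable_abse i3.
- have -> : EFin \o (fun t => `|f t|) \_ `[x - s, x + s] = (abse \o (EFin \o f)) \_ `[x - s, x + s].
    by rewrite -restrict_EFin.
  apply/integrable_restrict => //=; rewrite setTI; apply: integrableS (_ : mu.-integrable setT _) => //.
  exact: integrable_abse.
- move=> t _; rewrite !patchE !mem_setE !in_itv /= andbT.
  case: (leP x t) => xt; case: (leP (x - s) t) => xst /=; case: (leP t (x + s)) => tx /=; try lra.
  + have -> : f t * ramp x s t - f t = - (f t * (1 - ramp x s t)) by ring.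
    rewrite normrN normrM ler_piMr//.
    by rewrite ger0_norm ?subr_ge0 ?ramp_le1// gerBl ramp_ge0.
  + by rewrite ramp_right ?(ltW tx)// mulr1 subrr normr0.
  + by rewrite subr0 normrM ler_piMr// norm_ramp.
  + by rewrite ramp_left ?(ltW xst)// mulr0 subr0 normr0.
Unshelve. all: by end_near. Qed.
End WeakDerivative.

(** * The fundamental theorem of calculus for weak derivatives *)

Section WeakFTC.
Context {R : realType}.
Local Notation mu := (@lebesgue_measure R).
Implicit Types (f g u k : R -> R) (s t x y : R).

Lemma locally_integrable_segment a b c d f :
  locally_integrable `]a, b[ f -> a < c -> d < b -> mu.-integrable `[c, d] (EFin \o f).
Proof.
move=> [mf _ fi] ac db.
have cdab : `[c, d] `<=` `]a, b[ by apply: subset_itv; rewrite bnd_simp.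
apply/integrableP; split.
  by apply/measurable_EFinP; apply: measurable_funS mf.
exact: (fi _ cdab (@segment_compact _ _ _)).
Qed.

Lemma integrable_patch_segment c d f : mu.-integrable `[c, d] (EFin \o f) ->
  mu.-integrable setT (EFin \o (f \_ `[c, d])).
Proof.
move=> fi; rewrite -restrict_EFin; apply/integrable_restrict => //=.
by rewrite setTI.
Qed.

Lemma is_derive_ramp_difference x y s t :
  is_derive t (1:R) (fun t => ramp x s t - ramp y s t) (tent x s t - tent y s t).
Proof.
have h1 := is_derive_ramp x s t. have h2 := is_derive_ramp y s t.
exact: is_deriveB.
Qed.

Lemma ramp_difference_test a b x y s : 0 < s -> a < x - s -> x < y -> y + s < b ->
  test_function a b (fun t => ramp x s t - ramp y s t).
Proof.
move=> s0 ax xy yb.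
have dR := is_derive_ramp_difference x y s.
have sub : closure [set t | ramp x s t - ramp y s t != 0] `<=` `[x - s, y + s].
  rewrite closureE; apply: smallest_sub; first exact: itv_closed.
  move=> t /=; rewrite in_itv/=; apply: contraNT.
  rewrite negb_and -!ltNge => /orP[|] tl; apply/eqP.
    by rewrite !ramp_left ?subr0//; lra.
  by rewrite !ramp_right ?subrr//; lra.
split.
- by move=> t; have [] := dR t.
- have -> : derive1 (fun t => ramp x s t - ramp y s t) = (fun t => tent x s t - tent y s t).
    by apply/funext => t; rewrite derive1E; have [] := dR t.
  by move=> t; apply: cvgB; exact: continuous_tent.
- apply: subclosed_compact sub; first exact: closed_closure.
  exact: segment_compact.
- by apply: subset_trans sub _; apply: subset_itv; rewrite bnd_simp.
Qed.

Lemma tent_difference_out c d x y s t : 0 < s -> x < y -> c <= x - s -> y + s <= d ->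
  t <= c \/ d <= t -> tent x s t - tent y s t = 0.
Proof.
move=> s0 xy cx yd tcd; rewrite !tent_out ?subrr// ler_normr; apply/orP.
- by case: tcd => ?; [right; lra|left; lra].
- by case: tcd => ?; [right; lra|left; lra].
Qed.

Lemma ramp_difference_out c d x y s t : 0 < s -> x < y -> c <= x - s -> y + s <= d ->
  t <= c \/ d <= t -> ramp x s t - ramp y s t = 0.
Proof.
move=> s0 xy cx yd [tc|td].
- by rewrite !ramp_left ?subrr//; lra.
- by rewrite !ramp_right ?subrr//; lra.
Qed.

Lemma patch_mul a b c d (f k : R -> R) : a < c -> d < b ->
  (forall t, t <= c \/ d <= t -> k t = 0) ->
  (fun t => f t * k t) \_ `]a, b[ = (fun t => (f \_ `[c, d]) t * k t).
Proof.
move=> ac db k0; apply/funext => t; rewrite !patchE !mem_setE !in_itv /=.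
case: (boolP (c <= t <= d)) => [/andP[ct td]|tcd].
  by rewrite ifT//; apply/andP; split; [exact: lt_le_trans ct|exact: le_lt_trans db].
rewrite mul0r k0 ?mulr0 ?if_same//.
by move: tcd; rewrite negb_and -!ltNge => /orP[/ltW|/ltW]; [left|right].
Qed.

Lemma four_quarters (p p' q q' r r' t t' e : R) :
  `|p - p'| <= e / 4 -> `|q - q'| <= e / 4 -> `|r - r'| <= e / 4 ->
  `|t - t'| <= e / 4 -> p - q = - (r - t) -> `|q' - p' - (r' - t')| <= e.
Proof.
rewrite !ler_norml => /andP[? ?] /andP[? ?] /andP[? ?] /andP[? ?] ?.
by apply/andP; split; lra.
Qed.

(** Test the weak derivative against [ramp x s - ramp y s], a C^1 approximation of
    the indicator of [x, y] whose derivative is the difference of two tents.  As s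
    tends to 0 the tents pick the values of u at the Lebesgue points x and y, and
    the ramps produce the integral of g. *)
Lemma weak_ftc a b c d u g x y : is_weak_derivative a b u g ->
  a < c -> d < b -> c < x -> x < y -> y < d ->
  lebesgue_pt (u \_ `[c, d]) x -> lebesgue_pt (u \_ `[c, d]) y ->
  u y - u x = \int[mu]_(t in `[x, y]) g t.
Proof.
move=> [lu lg wug] ac db cx xy yd Lx Ly.
pose U := u \_ `[c, d]; pose G := g \_ `[c, d].
have iu := integrable_patch_segment (locally_integrable_segment lu ac db).
have ig := integrable_patch_segment (locally_integrable_segment lg ac db).
rewrite -/U in iu Lx Ly; rewrite -/G in ig.
have Ux : U x = u x by rewrite /U patchE mem_setE in_itv/= ifT//; lra.
have Uy : U y = u y by rewrite /U patchE mem_setE in_itv/= ifT//; lra.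
have Gxy : \int[mu]_(t in `[x, y]) g t =
    \int[mu]_(t in `[x, +oo[) G t - \int[mu]_(t in `[y, +oo[) G t.
  have -> : \int[mu]_(t in `[y, +oo[) G t = \int[mu]_(t in `]y, +oo[) G t.
    by rewrite -Rintegral_itv_obnd_cbnd//; apply: integrableS ig.
  rewrite -(@Rintegral_itvB _ G (BLeft x) +oo%O y) ?bnd_simp//; last 2 first.
  - by apply: integrableS ig.
  - exact: ltW.
  rewrite subKr; apply: eq_Rintegral => t; rewrite inE/= in_itv/= => /andP[xt ty].
  by rewrite /G patchE mem_setE in_itv/= ifT//; lra.
rewrite Gxy -Ux -Uy.
apply/eqP; rewrite -subr_eq0 -normr_le0; apply/ler_addgt0Pr => e e0; rewrite add0r.
have e4 : 0 < e / 4 by rewrite divr_gt0.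
near (0:R)^'+ => s.
have s0 : 0 < s by near: s; exact: nbhs_right_gt.
have sx : s < x - c by near: s; apply: nbhs_right_lt; rewrite subr_gt0.
have sy : s < d - y by near: s; apply: nbhs_right_lt; rewrite subr_gt0.
have h1 : `|\int[mu]_t (U t * tent x s t) - U x| <= e / 4.
  by near: s; exact: tent_approx.
have h2 : `|\int[mu]_t (U t * tent y s t) - U y| <= e / 4.
  by near: s; exact: tent_approx.
have h3 : `|\int[mu]_t (G t * ramp x s t) - \int[mu]_(t in `[x, +oo[) G t| <= e / 4.
  by near: s; exact: ramp_approx.
have h4 : `|\int[mu]_t (G t * ramp y s t) - \int[mu]_(t in `[y, +oo[) G t| <= e / 4.
  by near: s; exact: ramp_approx.
suff E : \int[mu]_t (U t * tent x s t) - \int[mu]_t (U t * tent y s t) =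
    - (\int[mu]_t (G t * ramp x s t) - \int[mu]_t (G t * ramp y s t)).
  exact: four_quarters h1 h2 h3 h4 E.
rewrite -!RintegralB//; first last.
- exact: (integrable_mul_bounded iu (@continuous_tent _ y s) (fun t => norm_tent y t s0)).
- exact: (integrable_mul_bounded iu (@continuous_tent _ x s) (fun t => norm_tent x t s0)).
- exact: (integrable_mul_bounded ig (@continuous_ramp _ y s) (fun t => norm_ramp y t s0)).
- exact: (integrable_mul_bounded ig (@continuous_ramp _ x s) (fun t => norm_ramp x t s0)).
have tf : test_function a b (fun t => ramp x s t - ramp y s t).
  have axs : a < x - s by move: ac sx; clear; lra.
  have ysb : y + s < b by move: db sy; clear; lra.
  exact: ramp_difference_test.
have := wug _ tf.
have -> : derive1 (fun t => ramp x s t - ramp y s t) = (fun t => tent x s t - tent y s t).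
  by apply/funext => t; rewrite derive1E; have [] := is_derive_ramp_difference x y s t.
rewrite [in X in X = _ -> _]Rintegral_mkcond [in X in _ = X -> _]Rintegral_mkcond.
have cxs : c <= x - s by move: sx; clear; lra.
have ysd : y + s <= d by move: sy; clear; lra.
have -> : (fun t => u t * (tent x s t - tent y s t)) \_ `]a, b[ =
    (fun t => U t * (tent x s t - tent y s t)).
  by apply: patch_mul ac db _ => t tcd; exact: tent_difference_out s0 xy cxs ysd tcd.
have -> : (fun t => g t * (ramp x s t - ramp y s t)) \_ `]a, b[ =
    (fun t => G t * (ramp x s t - ramp y s t)).
  by apply: patch_mul ac db _ => t tcd; exact: ramp_difference_out s0 xy cxs ysd tcd.
by under eq_Rintegral do rewrite mulrBr; under [in X in _ = - X -> _]eq_Rintegral do rewrite mulrBr.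
Unshelve. all: by end_near. Qed.

End WeakFTC.

Section Representative.
Context {R : realType}.
Local Notation mu := (@lebesgue_measure R).
Implicit Types (f g u U : R -> R) (s t x y : R).

(** All that the energy estimates retain of the relation U' = g: it bounds the
    increments of U by integrals of |g|, and it is stable under U -> -U with the
    same g. *)
Definition controlled_by U g : Prop :=
  [/\ continuous U, mu.-integrable setT (EFin \o g) &
      forall s t, s <= t -> (`|U t - U s|%:E <= \int[mu]_(x in `[s, t]) `|g x|%:E)%E].

Lemma integral_norm_segment g s t : mu.-integrable setT (EFin \o g) ->
  (\int[mu]_(x in `[s, t]) `|g x|%:E = (\int[mu]_(x in `[s, t]) `|g x|)%:E)%E.
Proof.
move=> gi; rewrite /Rintegral fineK//.
have gst : mu.-integrable `[s, t] (EFin \o g) by apply: integrableS gi.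
have mI : measurable (`[s, t] : set (measurableTypeR R)) by exact: measurable_itv.
exact: (integrable_fin_num mI (integrable_abse gst)).
Qed.

Lemma primitive_increment k g s t : mu.-integrable setT (EFin \o g) -> s <= t ->
  let U x := k + \int[mu]_(y in `]-oo, x]) g y in
  U t - U s = \int[mu]_(y in `[s, t]) g y.
Proof.
move=> gi st U.
rewrite -Rintegral_itv_obnd_cbnd; last by apply: integrableS gi.
rewrite -(@Rintegral_itvB _ g -oo%O (BRight t) s) ?bnd_simp//.
  by rewrite /U opprD addrACA subrr add0r.
by apply: integrableS gi.
Qed.

Lemma primitive_controlled k g : mu.-integrable setT (EFin \o g) ->
  controlled_by (fun x => k + \int[mu]_(y in `]-oo, x]) g y) g.
Proof.
move=> gi; set U := fun x => _.
have H s t : s <= t -> `|U t - U s| <= \int[mu]_(x in `[s, t]) `|g x|.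
  move=> st; rewrite /U (primitive_increment k gi st).
  by apply: le_normr_Rintegral => //; apply: integrableS gi.
split => //; last by move=> s t st; rewrite integral_norm_segment// lee_fin H.
move=> x; apply/cvgrPdist_le => e e0.
have [d [d0 dH]] := integral_normr_continuous gi e0.
have K s t : s <= t -> t - s < d -> `|U t - U s| <= e.
  move=> st tsd; apply: le_trans (H _ _ st) _; apply: ltW.
  have md : (mu `[s, t] < d%:E)%E.
    rewrite lebesgue_measure_itv/=; case: ifPn => _; last by rewrite lte_fin.
    by rewrite -EFinD lte_fin.
  exact: dH (measurable_itv _) md.
near=> t.
have xt : `|x - t| < d by near: t; exact: cvgr_dist_lt.
case: (leP x t) => h; move: xt; rewrite ltr_norml => /andP[? ?].
- by rewrite distrC K//; lra.
- by rewrite K//; lra.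
Unshelve. all: by end_near. Qed.

Lemma controlled_byN U g : controlled_by U g -> controlled_by (fun x => - U x) g.
Proof.
move=> [cU gi H]; split => //; first by move=> x; apply: cvgN; exact: cU.
by move=> s t st; rewrite -opprD normrN H.
Qed.

(** Almost every point is a Lebesgue point of u, and between two of these [weak_ftc]
    identifies the increments of u with those of a primitive of g. *)
Lemma weak_derivative_representative a b c d u g :
  is_weak_derivative a b u g -> a < c -> d < b ->
  exists2 U, controlled_by U (g \_ `[c, d]) &
    {ae mu, forall x, x \in `]c, d[ -> U x = u x}.
Proof.
move=> wug ac db; have [lu lg _] := wug.
have iu := locally_integrable_segment lu ac db.
have ig := integrable_patch_segment (locally_integrable_segment lg ac db).
have Leb : {ae mu, forall x, lebesgue_pt (u \_ `[c, d]) x}.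
  apply: lebesgue_differentiation.
  by apply: integrable_locally_restrict.
have [[x0 [x0cd Lx0]]|none] :=
  pselect (exists x0, (x0 \in `]c, d[) /\ lebesgue_pt (u \_ `[c, d]) x0).
- pose P x := \int[mu]_(y in `]-oo, x]) (g \_ `[c, d]) y.
  exists (fun x => (u x0 - P x0) + P x); first exact: primitive_controlled.
  have K x y : x \in `]c, d[ -> y \in `]c, d[ -> x < y ->
    lebesgue_pt (u \_ `[c, d]) x -> lebesgue_pt (u \_ `[c, d]) y ->
    u y - u x = P y - P x.
    rewrite !in_itv/= => /andP[cx xd] /andP[cy yd] xy Lx Ly.
    rewrite (weak_ftc wug ac db cx xy yd Lx Ly).
    have := primitive_increment 0 ig (ltW xy); rewrite /= !add0r => ->.
    apply: eq_Rintegral => t; rewrite inE/= in_itv/= => /andP[xt ty].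
    by rewrite patchE mem_setE in_itv/= ifT//; lra.
  move: Leb; apply: filterS; first exact: (ae_filter_ringOfSetsType mu).
  move=> x Lx xcd.
  have [xx|xx|->] := ltgtP x x0.
  + by have := K _ _ xcd x0cd xx Lx Lx0; lra.
  + by have := K _ _ x0cd xcd xx Lx0 Lx; lra.
  + by lra.
- exists (fun x => 0 + \int[mu]_(y in `]-oo, x]) (g \_ `[c, d]) y).
    exact: primitive_controlled.
  move: Leb; apply: filterS; first exact: (ae_filter_ringOfSetsType mu).
  move=> x Lx xcd; exfalso; apply: none; by exists x.
Qed.

End Representative.

(** * A chain rule inequality *)

Section Chain.
Context {R : realType}.
Local Notation mu := (@lebesgue_measure R).
Implicit Types (f g u U : R -> R) (s t x y : R).

Lemma ge0_integral_split (f : R -> \bar R) x m y : x <= m -> m <= y ->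
  measurable_fun `[x, y] f -> (forall t, t \in `[x, y] -> (0 <= f t)%E) ->
  (\int[mu]_(t in `[x, y]) f t =
   \int[mu]_(t in `[x, m]) f t + \int[mu]_(t in `[m, y]) f t)%E.
Proof.
move=> xm my mf f0.
have E : `[x, y]%classic = `[x, m] `|` `]m, y].
  by rewrite -itv_bndbnd_setU// bnd_simp.
rewrite E ge0_integral_setU//; last 3 first.
- by rewrite -E.
- by move=> t; rewrite -E => /f0.
- apply/disj_set2P; rewrite -subset0 => z/=; rewrite !in_itv/= => -[/andP[_ +] /andP[+ _]]; lra.
rewrite integral_itv_obnd_cbnd//.
apply: measurable_funS mf => //.
by apply: subset_itv; rewrite bnd_simp.
Qed.

(** The two endpoints may come in either order, since they will be two values of a
    function that is not monotone. *)
Lemma MVT_between (Psi psi : R -> R) (p q : R) :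
  (forall w, Num.min p q <= w <= Num.max p q -> is_derive w (1:R) Psi (psi w)) ->
  exists2 w, Num.min p q <= w <= Num.max p q & Psi q - Psi p = psi w * (q - p).
Proof.
have K (a b : R) : a <= b -> (forall w, a <= w <= b -> is_derive w (1:R) Psi (psi w)) ->
    exists2 w, a <= w <= b & Psi b - Psi a = psi w * (b - a).
  move=> ab d; have [] := @MVT_segment R Psi psi a b ab.
  - by move=> w; rewrite in_itv/= => /andP[? ?]; apply: d; lra.
  - apply: derivable_within_continuous => w; rewrite in_itv/= => h.
    by have [] := d _ h.
  - by move=> w; rewrite in_itv/= => h E; exists w.
case: (leP p q) => pq d; first exact: K.
have [w wpq E] := K _ _ (ltW pq) d.
by exists w => //; lra.
Qed.

Lemma close_lt (p q w r : R) : `|p - q| < r / 2 -> `|q - w| < r / 2 -> `|p - w| < r.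
Proof. by move=> h1 h2; have := ler_distD q p w; lra. Qed.

Lemma close_le (p q w r : R) : `|p - q| <= r / 2 -> `|p - w| <= r / 2 -> `|q - w| <= r.
Proof. by move=> h1 h2; have := ler_distD p q w; rewrite (distrC q p); lra. Qed.

(** Heine-Cantor, with continuity in the sense of the whole line at each point of
    the segment. *)
Lemma uniformly_close f x y e : 0 < e -> (forall t, t \in `[x, y] -> {for t, continuous f}) ->
  exists2 d, 0 < d & forall s t, s \in `[x, y] -> t \in `[x, y] -> `|s - t| < d ->
    `|f s - f t| <= e.
Proof.
move=> e0 cf.
have /compact_near_coveringP/(_ R (0^'+)
   (fun d s => forall t, `|s - t| < d -> `|f s - f t| <= e) _) := @segment_compact R x y.
move=> /(_ _) H.
have : \forall d \near (0:R)^'+, `[x, y] `<=` (fun s => forall t, `|s - t| < d -> `|f s - f t| <= e).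
  apply: H => z zxy.
  have e2 : 0 < e / 2 by rewrite divr_gt0.
  have := cf _ zxy => /cvgrPdist_le /(_ _ e2) /nbhs_ballP [r /= r0 rH].
  have r2 : 0 < r / 2 by rewrite divr_gt0.
  near=> s d => t.
  have sz : `|z - s| < r / 2 by near: s; exact: cvgr_dist_lt.
  have dr : d < r / 2 by near: d; exact: nbhs_right_lt.
  move=> st.
  have h1 : `|f z - f s| <= e / 2.
    by apply: rH; rewrite /ball/=; lra.
  have h2 : `|f z - f t| <= e / 2.
    apply: rH; rewrite /ball/=.
    by apply: (close_lt sz); exact: lt_trans st dr.
  exact: close_le h1 h2.
move=> Hd; near (0:R)^'+ => d.
exists d; first by near: d; exact: nbhs_right_gt.
move=> s t sxy txy.
have : `[x, y] `<=` (fun s => forall t, `|s - t| < d -> `|f s - f t| <= e) by near: d.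
by apply.
Unshelve. all: by end_near. Qed.

Section chain_inequality.
Variables (U g Psi psi : R -> R) (x y : R).
Hypotheses (Ug : controlled_by U g) (xy : x <= y).
Hypothesis dPsi : forall t, t \in `[x, y] -> is_derive (U t) (1:R) Psi (psi (U t)).
Hypothesis cpsi : forall t, t \in `[x, y] -> {for U t, continuous psi}.

Let cpsiU t : t \in `[x, y] -> {for t, continuous (psi \o U)}.
Proof. by move=> txy; apply: continuous_comp; [case: Ug => cU _ _; exact: cU|exact: cpsi]. Qed.

Lemma measurable_comp_controlled : measurable_fun `[x, y] (psi \o U).
Proof.
apply: subspace_continuous_measurable_fun => //.
by apply: continuous_in_subspaceT => t; rewrite inE; exact: cpsiU.
Qed.

Let mg : measurable_fun setT g.
Proof. by case: Ug => _ /integrableP[/measurable_EFinP]. Qed.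

(** On a piece where psi (U t) oscillates by at most e, the mean value theorem gives
    |Psi (U t) - Psi (U s)| = |psi (U z)| |U t - U s| for some z of the piece, and
    |U t - U s| is at most the integral of |g|. *)
Let piece (e d s t : R) : 0 < e -> (forall s t, s \in `[x, y] -> t \in `[x, y] -> `|s - t| < d ->
    `|psi (U s) - psi (U t)| <= e) -> x <= s -> s <= t -> t <= y -> t - s < d ->
  (`|Psi (U t) - Psi (U s)|%:E <=
    \int[mu]_(z in `[s, t]) ((`|psi (U z)| + e) * `|g z|)%:E)%E.
Proof.
move=> e0 dH xs st ty tsd; have [cU gi H] := Ug.
have stxy z : z \in `[s, t] -> z \in `[x, y] by rewrite !in_itv/= => /andP[? ?]; lra.
have val w : Num.min (U s) (U t) <= w <= Num.max (U s) (U t) ->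
    exists2 z, z \in `[s, t] & U z = w.
  apply: IVT => //; exact: continuous_subspaceT.
have [w /val[z zst <-] ->] : exists2 w, Num.min (U s) (U t) <= w <= Num.max (U s) (U t)
    & Psi (U t) - Psi (U s) = psi w * (U t - U s).
  by apply: MVT_between => w /val[z zst <-]; apply/dPsi/stxy.
rewrite normrM EFinM.
apply: (@le_trans _ _ (`|psi (U z)|%:E * \int[mu]_(z in `[s, t]) `|g z|%:E)%E).
  by apply: lee_wpmul2l => //; rewrite H.
have mgst : measurable_fun `[s, t] (fun z => `|g z|%:E).
  by apply/measurable_EFinP; apply: measurableT_comp => //; exact: measurable_funTS.
rewrite -ge0_integralZl_EFin//.
apply: ge0_le_integral => //.
- by apply: measurable_funeM.
- apply/measurable_EFinP; apply: measurable_funM.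
    apply: measurable_funD => //; apply: measurableT_comp => //.
    by apply: measurable_funS measurable_comp_controlled => //.
  by apply/measurable_EFinP.
- move=> q qst; rewrite -EFinM lee_fin ler_wpM2r//.
  have qz : `|z - q| < d.
    move: zst qst; rewrite /= !in_itv/= => /andP[? ?] /andP[? ?].
    by rewrite ltr_norml; apply/andP; split; lra.
  have := dH _ _ (stxy _ zst) (stxy _ qst) qz.
  have := ler_normD (psi (U z) - psi (U q)) (psi (U q)).
  by rewrite subrK; lra.
Qed.

Let mweight (e : R) : measurable_fun `[x, y] (fun z => ((`|psi (U z)| + e) * `|g z|)%:E).
Proof.
apply/measurable_EFinP; apply: measurable_funM.
  apply: measurable_funD => //; apply: measurableT_comp => //.
  exact: measurable_comp_controlled.
by apply: measurableT_comp => //; exact: measurable_funTS.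
Qed.

Let approx (e : R) : 0 < e ->
  (`|Psi (U y) - Psi (U x)|%:E <=
    \int[mu]_(z in `[x, y]) ((`|psi (U z)| + e) * `|g z|)%:E)%E.
Proof.
move=> e0.
have [d d0 dH] := uniformly_close e0 cpsiU.
have ge0 (z : R) : (0 <= ((`|psi (U z)| + e) * `|g z|)%:E)%E.
  by rewrite lee_fin mulr_ge0// addr_ge0// ltW.
(* Induction on the number of steps of length d / 2 needed to reach t from x. *)
suff K (n : nat) : forall t : R, x <= t -> t <= y -> t - x < n%:R * (d / 2) ->
    (`|Psi (U t) - Psi (U x)|%:E <=
    \int[mu]_(z in `[x, t]) ((`|psi (U z)| + e) * `|g z|)%:E)%E.
  have d2 : 0 < d / 2 by rewrite divr_gt0.
  apply: (K (Num.truncn ((y - x) / (d / 2))).+1) => //.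
  by rewrite -ltr_pdivrMr// truncnS_gt.
elim: n => [|n IH] t xt ty; first by rewrite mul0r subr_lt0 ltNge xt.
rewrite -natr1 mulrDl mul1r => tn.
have [small|big] := leP (t - d / 2) x.
  by apply: piece (dH) _ _ _ _ => //; lra.
have dm : 0 < d / 2 by rewrite divr_gt0.
have mt : t - d / 2 <= t by lra.
rewrite (ge0_integral_split (ltW big) mt)//; last first.
  apply: measurable_funS (mweight e) => //.
  by apply: subset_itv; rewrite bnd_simp.
apply: (@le_trans _ _ (`|Psi (U (t - d / 2)) - Psi (U x)|%:E +
    `|Psi (U t) - Psi (U (t - d / 2))|%:E)%E).
  by rewrite -EFinD lee_fin [leRHS]addrC ler_distD.
apply: leeD; first by apply: IH => //; lra.
by apply: piece (dH) _ _ _ _ => //; lra.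
Qed.

(** One half of the chain rule for Psi (U t): cut the segment into pieces on which
    psi (U t) is nearly constant, add the estimates of the pieces and let the
    oscillation tend to 0. *)
Lemma chain_inequality : (`|Psi (U y) - Psi (U x)|%:E <=
    \int[mu]_(z in `[x, y]) (`|psi (U z)| * `|g z|)%:E)%E.
Proof.
have [cU gi H] := Ug.
pose I := \int[mu]_(z in `[x, y]) `|g z|.
have I0 : 0 <= I by apply: Rintegral_ge0.
apply/lee_addgt0Pr => e e0.
have e1 : 0 < e / (I + 1) by rewrite divr_gt0// ltr_wpDl.
apply: le_trans (approx e1) _.
have mg' : measurable_fun `[x, y] (fun z => `|g z|).
  by apply: measurableT_comp => //; exact: measurable_funTS.
have m1 : measurable_fun `[x, y] (fun z => (`|psi (U z)| * `|g z|)%:E).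
  have := mweight 0; congr (measurable_fun _ _).
  by apply/funext => z; rewrite addr0.
under eq_integral do rewrite mulrDl EFinD.
rewrite ge0_integralD//=; last 2 first.
- by move=> z _; rewrite lee_fin mulr_ge0// ltW.
- by apply/measurable_EFinP; apply: measurable_funM.
rewrite leeD2l//.
under eq_integral do rewrite EFinM.
rewrite ge0_integralZl_EFin//; last 2 first.
- exact/measurable_EFinP.
- exact: ltW.
rewrite (integral_norm_segment _ _ gi) -EFinM lee_fin -/I.
rewrite mulrAC ler_pdivrMr ?ltr_wpDl//; nra.
Qed.

End chain_inequality.
End Chain.

(** * Young's inequality for the energy density *)

Section Profile.
Context {R : realType}.
Implicit Types (u x y t : R).

Lemma continuous_pos_part_powR (r : R) : 0 < r -> continuous (fun t : R => pos_part t `^ r).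
Proof.
move=> r0 t; case: (leP t 0) => t0.
  apply/cvgrPdist_le => e e0.
  have d0 : 0 < e `^ r^-1 by rewrite powR_gt0.
  near=> x.
  have -> : pos_part t = 0 by rewrite /pos_part max_r.
  rewrite powR0 ?gt_eqF// sub0r normrN ger0_norm ?powR_ge0//.
  have xd : x < e `^ r^-1 by near: x; apply: lt_nbhsl; exact: le_lt_trans d0.
  have -> : e = (e `^ r^-1) `^ r by rewrite -powRrM mulVf ?gt_eqF// powRr1// ltW.
  apply: ge0_ler_powR; rewrite ?nnegrE ?powR_ge0 ?(ltW r0)//.
    by rewrite /pos_part le_max lexx orbT.
  by rewrite /pos_part ge_max (ltW xd) (ltW d0).
apply: (@continuous_comp _ _ _ pos_part (fun x => x `^ r)).
  exact: continuous_pos_part.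
apply: differentiable_continuous; apply/derivable1_diffP; apply: derivable_powR.
by rewrite in_itv/= andbT /pos_part lt_max t0.
Unshelve. all: by end_near. Qed.

Variable p : R.
Hypothesis p1 : 1 < p.

Let pc := p / (p - 1).
Let p0 : 0 < p. Proof. by apply: lt_trans p1. Qed.
Let pm0 : 0 < p - 1. Proof. by rewrite subr_gt0. Qed.
Let pc0 : 0 < pc. Proof. by rewrite /pc divr_gt0. Qed.

Lemma lambda_gt0 : 0 < lambda_ p.
Proof. by rewrite /lambda_ mulr_gt0// powR_gt0//. Qed.

(** The normalization of lambda that makes the potential the p-th power of
    lambda |u^2 - 1| / 2 divided by the conjugate exponent p / (p - 1). *)
Lemma lambda_powp : lambda_ p `^ p = 2 `^ (p - 1) / (p - 1).
Proof.
rewrite /lambda_ powRM ?powR_ge0// -!powRrM mulrBl mulVf ?gt_eqF// mul1r.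
by rewrite mulNr mulVf ?gt_eqF// powR_inv1// ltW.
Qed.

Lemma potentialE u : potential p u = (lambda_ p * `|u ^+ 2 - 1| / 2) `^ p / pc.
Proof.
rewrite /potential mulrAC powRM//; last by rewrite divr_ge0// ltW// lambda_gt0.
rewrite powRM ?invr_ge0//; last exact: ltW lambda_gt0.
rewrite lambda_powp.
have -> : 2^-1 `^ p = (2 * 2 `^ (p - 1))^-1 :> R.
  by rewrite mulr_powRB1// -powRN -[X in X `^ p]powR_inv1// -powRrM mulN1r.
have := powR_gt0 (p - 1) (ltr0n R 2) => h.
by rewrite /pc; field; rewrite !gt_eqF.
Qed.

(** For -1 <= u <= 1 this is the optimal S in Young's inequality
    S |q| <= |q|^p / p + F(u).  It is cut to 0 outside [-1, 1], which keeps it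
    continuous and makes its integral over the line equal to c_p. *)
Definition slope u := pos_part (lambda_ p * (1 - u ^+ 2) / 2) `^ (p - 1).

Lemma slope_ge0 u : 0 <= slope u.
Proof. exact: powR_ge0. Qed.

Lemma continuous_slope : continuous slope.
Proof.
move=> u; apply: (@continuous_comp _ _ _ (fun u => lambda_ p * (1 - u ^+ 2) / 2)
   (fun t => pos_part t `^ (p - 1))); last exact: continuous_pos_part_powR.
apply: cvgM; last exact: cvg_cst.
apply: cvgM; first exact: cvg_cst.
apply: cvgB; first exact: cvg_cst.
by apply: (@exprn_continuous _ 2).
Qed.

Lemma slope_out u : 1 <= u ^+ 2 -> slope u = 0.
Proof.
move=> u1; rewrite /slope /pos_part max_r ?powR0 ?gt_eqF//.
by have := lambda_gt0; nra.
Qed.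

Lemma slope_in u : u ^+ 2 <= 1 -> slope u = (lambda_ p * `|u ^+ 2 - 1| / 2) `^ (p - 1).
Proof.
move=> u1; rewrite /slope /pos_part max_l.
  by rewrite ler0_norm ?subr_le0// opprB.
by have := lambda_gt0; nra.
Qed.

Lemma slopeN u : slope (- u) = slope u.
Proof. by rewrite /slope sqrrN. Qed.

Lemma conj_exp (x : R) : (x `^ (p - 1)) `^ pc = x `^ p.
Proof. by rewrite -powRrM /pc mulrC divfK// gt_eqF. Qed.

Lemma slope_potential u : slope u `^ pc <= pc * potential p u.
Proof.
rewrite potentialE mulrC divfK ?gt_eqF//.
have [u1|u1] := leP (u ^+ 2) 1; first by rewrite slope_in// conj_exp.
by rewrite slope_out ?(ltW u1)// powR0 ?gt_eqF// powR_ge0.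
Qed.

Lemma potential_conj u : u ^+ 2 <= 1 ->
  (p / (p - 1)) `^ ((p - 1) / p) * potential p u `^ ((p - 1) / p) = slope u.
Proof.
move=> u1; rewrite -/pc -powRM ?potentialE; last 2 first.
- exact: ltW.
- by rewrite divr_ge0 ?powR_ge0// ltW.
rewrite mulrC divfK ?gt_eqF// -powRrM [p * _]mulrC divfK ?gt_eqF//.
by rewrite slope_in.
Qed.

(** Young's inequality for the product of eps^((p-1)/p) q and S / eps^((p-1)/p). *)
Lemma young (eps q S : R) : 0 < eps -> 0 <= q -> 0 <= S ->
  S * q <= eps `^ (p - 1) * q `^ p / p + S `^ pc / pc / eps.
Proof.
move=> e0 q0 S0.
pose w := eps `^ ((p - 1) / p).
have w0 : 0 < w by rewrite powR_gt0.
have -> : S * q = (w * q) * (S / w) by field; rewrite gt_eqF.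
have wq0 : 0 <= w * q by rewrite mulr_ge0// ltW.
have Sw0 : 0 <= S / w by rewrite divr_ge0// ltW.
have cj : p^-1 + pc^-1 = 1 by rewrite /pc; field; rewrite !gt_eqF.
apply: le_trans (conjugate_powR wq0 Sw0 p0 pc0 cj) _.
rewrite powRM ?(ltW w0)// powRM ?invr_ge0 ?(ltW w0)//.
have -> : w `^ p = eps `^ (p - 1) by rewrite /w -powRrM divfK// gt_eqF.
have -> : w^-1 `^ pc = eps^-1.
  rewrite -powR_inv1 ?(ltW w0)// -powRrM mulN1r powRN /w -powRrM.
  have -> : (p - 1) / p * pc = 1 by rewrite /pc; field; rewrite !gt_eqF.
  by rewrite powRr1// ltW.
by rewrite [X in _ <= _ + X]mulrAC.
Qed.

Definition density (eps q u : R) := eps `^ (p - 1) * `|q| `^ p / p + potential p u / eps.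

Lemma density_ge0 eps q u : 0 < eps -> 0 <= density eps q u.
Proof.
move=> e0; rewrite addr_ge0// ?divr_ge0 ?mulr_ge0 ?powR_ge0 ?(ltW p0) ?(ltW e0)//.
by rewrite invr_ge0 mulr_ge0 ?(ltW p0).
Qed.

Lemma density_ge_slope eps q u : 0 < eps -> slope u * `|q| <= density eps q u.
Proof.
move=> e0; apply: le_trans (young e0 (normr_ge0 q) (slope_ge0 u)) _.
rewrite /density lerD2l ler_pM2r ?invr_gt0// ler_pdivrMr// mulrC.
exact: slope_potential.
Qed.

(** Small enough for [barrier_slope_ge0] and [barrier_density]: lowering the slope by
    barrier_coef m^p / (1 - u), where 1 - u >= m, changes it by a fraction zeta such
    that p / (p - 1) * zeta <= 1 / 16. *)
Definition barrier_coef := (7 / 8 * lambda_ p) `^ (p - 1) / (16 * pc).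

Lemma barrier_coef_gt0 : 0 < barrier_coef.
Proof.
by apply: divr_gt0; [rewrite powR_gt0// mulr_gt0 ?lambda_gt0// divr_gt0|rewrite mulr_gt0].
Qed.

(** The power is at most exp (- x) for x = pc * z, and exp (- x) <= 1 / (1 + x)
    <= 1 - x (1 - x). *)
Lemma onem_powR_le (z : R) : 0 <= z -> pc * z <= 1 / 16 -> z < 1 ->
  (1 - z) `^ pc <= 1 - 15 / 16 * (pc * z).
Proof.
move=> z0 zs z1.
have -> : (1 - z) `^ pc = expR (pc * ln (1 - z)).
  by rewrite /powR ifF// gt_eqF// subr_gt0.
have zpc : 0 <= pc * z by rewrite mulr_ge0// ltW.
have h1 : pc * ln (1 - z) <= - (pc * z).
  by rewrite -mulrN ler_wpM2l ?(ltW pc0)// le_ln1Dx// ltrN2.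
apply: (@le_trans _ _ (expR (- (pc * z)))); first by rewrite ler_expR.
rewrite expRN.
have h2 := expR_ge1Dx (pc * z).
have h3 : 0 < 1 + pc * z by lra.
apply: (@le_trans _ _ (1 + pc * z)^-1).
  by rewrite lef_pV2// posrE// expR_gt0.
rewrite -[X in X <= _]mul1r ler_pdivrMr//; nra.
Qed.

(** Near the well at 1 write z = 1 - u and G = lambda |u^2 - 1| / 2, so that
    slope u = G^(p-1) and F(u) = G^p / pc.  Lowering the slope to
    G^(p-1) - kappa / z frees the amount F(u) - (G^(p-1) - kappa / z)^pc / pc of
    potential, which to first order is kappa G / z, about kappa lambda.  This does
    not depend on u, and the lowered slope has an explicit primitive with a
    logarithmic loss. *)
Section barrier.
Variables (m u kappa z G : R).
Hypotheses (m0 : 0 < m) (u34 : 3 / 4 <= u) (um : u <= 1 - m).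
Hypotheses (kappaE : kappa = barrier_coef * m `^ p) (zE : z = 1 - u)
  (GE : G = lambda_ p * z * (2 - z) / 2).

Let z0 : 0 < z. Proof. move: m0 um zE; lra. Qed.
Let z14 : z <= 1 / 4. Proof. move: u34 zE; lra. Qed.
Let Gz : 7 / 8 * lambda_ p * z <= G.
Proof.
rewrite -subr_ge0.
have -> : G - 7 / 8 * lambda_ p * z = lambda_ p * z * (1 / 4 - z) / 2.
  by rewrite GE; field.
apply: divr_ge0 => //; apply: mulr_ge0; last by rewrite subr_ge0.
by apply: mulr_ge0; apply: ltW => //; exact: lambda_gt0.
Qed.
Let G0 : 0 < G. Proof. by apply: lt_le_trans Gz; rewrite mulr_gt0// mulr_gt0 ?lambda_gt0// divr_gt0. Qed.
Let slopeG : slope u = G `^ (p - 1).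
Proof.
rewrite slope_in ?ler0_norm; last 2 first.
- by move: z0 z14 zE; nra.
- by move: z0 z14 zE; nra.
by congr (_ `^ _); rewrite GE zE; field.
Qed.
Let potG : potential p u = G `^ p / pc.
Proof.
rewrite potentialE ler0_norm; last by move: z0 z14 zE; nra.
by congr (_ `^ _ / _); rewrite GE zE; field.
Qed.

Let zeta := kappa / (z * G `^ (p - 1)).

Let zeta_le : pc * zeta <= 1 / 16.
Proof.
have h : m `^ p * (7 / 8 * lambda_ p) `^ (p - 1) <= z * G `^ (p - 1).
  apply: (@le_trans _ _ (z * (7 / 8 * lambda_ p * z) `^ (p - 1))).
    rewrite [X in _ <= _ * X]powRM ?(ltW z0)//; last by rewrite mulr_ge0 ?(ltW lambda_gt0)// divr_ge0.
    rewrite [leRHS]mulrCA mulr_powRB1 ?(ltW z0)// [leRHS]mulrC ler_wpM2r ?powR_ge0//.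
    apply: ge0_ler_powR; rewrite ?nnegrE ?(ltW p0) ?(ltW m0) ?(ltW z0)//.
    by move: um zE; lra.
  rewrite ler_wpM2l ?(ltW z0)//; apply: ge0_ler_powR; rewrite ?nnegrE ?(ltW pm0) ?(ltW G0)//.
  by rewrite mulr_ge0 ?(ltW z0)// mulr_ge0 ?(ltW lambda_gt0)// divr_ge0.
rewrite /zeta kappaE /barrier_coef [leLHS]mulrA ler_pdivrMr ?mulr_gt0 ?powR_gt0//.
apply: (@le_trans _ _ (1 / 16 * (m `^ p * (7 / 8 * lambda_ p) `^ (p - 1)))).
  by rewrite le_eqVlt; apply/orP; left; apply/eqP; field; rewrite gt_eqF.
by rewrite ler_wpM2l.
Qed.

Let zeta0 : 0 <= zeta.
Proof.
rewrite /zeta kappaE; apply: divr_ge0; apply: mulr_ge0; rewrite ?powR_ge0//; apply: ltW => //.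
exact: barrier_coef_gt0.
Qed.

Let pc1 : 1 <= pc.
Proof. by rewrite /pc ler_pdivlMr// mul1r; move: p1; lra. Qed.

Let zeta1 : zeta < 1.
Proof. move: pc1 zeta_le zeta0; nra. Qed.

Let slopeE : slope u - kappa / z = G `^ (p - 1) * (1 - zeta).
Proof.
have h : 0 < G `^ (p - 1) by rewrite powR_gt0.
by rewrite slopeG /zeta; field; rewrite !gt_eqF.
Qed.

(** The fraction zeta by which the slope is lowered is less than 1. *)
Lemma barrier_slope_ge0 : 0 <= slope u - kappa / z.
Proof. by rewrite slopeE mulr_ge0 ?powR_ge0// subr_ge0 ltW. Qed.

(** The factor 105/128 is 15/16 * 7/8: 15/16 is the second order loss of
    [onem_powR_le], and 7/8 bounds (2 - z) / 2 from below, as z <= 1/4. *)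
Lemma barrier_density eps q : 0 < eps ->
  (slope u - kappa / z) * `|q| + 105 / 128 * kappa * lambda_ p / eps <=
  density eps q u.
Proof.
move=> e0; have S0 := barrier_slope_ge0.
have := young e0 (normr_ge0 q) S0.
rewrite /density => Y; rewrite -lerBrDr; apply: le_trans Y _.
rewrite -addrA lerD2l -mulrBl ler_pM2r ?invr_gt0//.
rewrite slopeE powRM ?powR_ge0 ?subr_ge0 ?(ltW zeta1)// conj_exp potG.
rewrite ler_pdivrMr// mulrBl divfK ?gt_eqF//.
have h := onem_powR_le zeta0 zeta_le zeta1.
apply: (@le_trans _ _ (G `^ p * (1 - 15 / 16 * (pc * zeta)))).
  by rewrite ler_wpM2l ?powR_ge0.
rewrite mulrBr mulr1 lerD2l lerN2.
have -> : G `^ p * (15 / 16 * (pc * zeta)) = 15 / 16 * kappa * (G / z) * pc.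
  rewrite -(mulr_powRB1 (ltW G0) p0) /zeta; field.
  by rewrite !gt_eqF ?powR_gt0.
rewrite ler_pM2r//.
have k0 : 0 <= kappa by rewrite kappaE mulr_ge0 ?powR_ge0// ltW// barrier_coef_gt0.
have gz : 7 / 8 * lambda_ p <= G / z by rewrite ler_pdivlMr.
nra.
Qed.

End barrier.
End Profile.

(** * The action of a transition *)

Section Action.
Context {R : realType}.
Local Notation mu := (@lebesgue_measure R).
Variable p : R.
Hypothesis p1 : 1 < p.
Implicit Types (u w t : R).

(** For u in [-1, 1], the infimum of the energy of a transition from -1 to u when
    time is not limited. *)
Definition action u := \int[mu]_(t in `]-oo, u]) slope p t.

Lemma slope_restrict : slope p = slope p \_ `[-1, 1].
Proof.
apply/funext => t; rewrite patchE mem_setE in_itv/=; case: ifPn => // t1.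
by apply: (slope_out p1); move: t1; rewrite negb_and -!ltNge => /orP[]; nra.
Qed.

Lemma integrable_slope : mu.-integrable setT (EFin \o slope p).
Proof.
rewrite slope_restrict; apply: integrable_patch_segment.
apply: continuous_compact_integrable; first exact: segment_compact.
by apply: continuous_subspaceT; exact: continuous_slope.
Qed.

Lemma is_derive_action u : is_derive u (1:R) action (slope p u).
Proof.
have u1 : u < u + 1 by rewrite ltrDl.
have iu : mu.-integrable `]-oo, u + 1] (EFin \o slope p).
  by apply: integrableS integrable_slope.
have [d E] := continuous_FTC1 u1 iu (ltNyr u) (@continuous_slope _ _ p1 u).
by apply: DeriveDef; [exact: d|rewrite -derive1E; exact: E].
Qed.

Lemma action_MVT a b : a <= b ->
  exists2 w, a <= w <= b & action b - action a = slope p w * (b - a).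
Proof.
move=> ab; have [|w] := @MVT_between R action (slope p) a b.
  by move=> w _; exact: is_derive_action.
by rewrite min_l// max_r//; exists w.
Qed.

Lemma action_nondecreasing a b : a <= b -> action a <= action b.
Proof.
move=> ab; have [w _ E] := action_MVT ab.
by rewrite -subr_ge0 E mulr_ge0 ?slope_ge0// subr_ge0.
Qed.

Lemma action_leN1 u : u <= -1 -> action u = 0.
Proof.
move=> u1; rewrite /action.
transitivity (\int[mu]_(t in `]-oo, u]) (cst 0 t : R)); last by rewrite Rintegral_cst// mul0r.
apply: eq_Rintegral => t; rewrite inE/= in_itv/= => tu.
by apply: (slope_out p1); nra.
Qed.

Lemma action1 : action 1 = c_ p.
Proof.
have -> : action 1 = \int[mu]_(t in `[-1, 1]) slope p t.
  rewrite /action {1}slope_restrict [RHS]Rintegral_mkcond Rintegral_mkcond.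
  congr (Rintegral _ _ _); apply/funext => t; rewrite !patchE !mem_setE !in_itv/=.
  by case: (boolP (t <= 1)) => t1; rewrite ?andbT ?andbF.
pose k := (p / (p - 1)) `^ ((p - 1) / p).
have k0 : 0 < k by rewrite powR_gt0// divr_gt0 ?subr_gt0// (lt_trans _ p1).
rewrite /c_ -/k -RintegralZl//.
  apply: eq_Rintegral => t; rewrite inE/= in_itv/= => /andP[t1 t2].
  by rewrite -potential_conj//; nra.
have i1 : mu.-integrable `[-1, 1] (EFin \o slope p).
  by apply: integrableS integrable_slope.
have mI : measurable (`[-1, 1] : set (measurableTypeR R)) by exact: measurable_itv.
have i2 := integrableZl mI k^-1 i1.
apply: eq_integrable i2 => // t; rewrite inE/= in_itv/= => /andP[t1 t2].
rewrite -EFinM; congr EFin.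
by rewrite -(potential_conj p1); [rewrite mulKf// gt_eqF|nra].
Qed.

(** [slope] is even, so the left-hand side has derivative 0. *)
Lemma actionN u : action u + action (- u) = c_ p.
Proof.
pose f := fun t => action t + action (- t).
have d t : is_derive t (1:R) f 0.
  have h1 := is_derive_action t.
  have h2 : is_derive t (1:R) (action \o -%R) (slope p (- t) * -1).
    exact: (is_derive1_comp (is_derive_action (- t)) (is_deriveNid t 1)).
  have : is_derive t (1:R) (action \+ (action \o -%R)) (slope p t + slope p (- t) * -1).
    exact: is_deriveD.
  by rewrite slopeN mulrN1 subrr.
rewrite -[LHS]/(f u) (is_derive_0_is_cst u 1 d) /f.
by rewrite (@action_leN1 (- 1))// addr0 action1.
Qed.

Lemma slope_nonincreasing u w : 0 <= u -> u <= w -> slope p w <= slope p u.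
Proof.
move=> u0 uw; apply: ge0_ler_powR; rewrite ?nnegrE.
- by rewrite subr_ge0 ltW.
- by rewrite /pos_part le_max lexx orbT.
- by rewrite /pos_part le_max lexx orbT.
have := lambda_gt0 p1 => l0.
have h : lambda_ p * (1 - w ^+ 2) / 2 <= lambda_ p * (1 - u ^+ 2) / 2.
  rewrite ler_pM2r ?invr_gt0// ler_pM2l//; nra.
by rewrite /pos_part ge_max !le_max h lexx orbT.
Qed.

Lemma action_increment_le a b : 0 <= a -> a <= b ->
  action b - action a <= (b - a) * slope p a.
Proof.
move=> a0 ab; have [w /andP[aw wb] ->] := action_MVT ab.
by rewrite mulrC ler_wpM2l ?subr_ge0// slope_nonincreasing.
Qed.

Lemma action_increment_ge a b : 0 <= a -> a <= b ->
  (b - a) * slope p b <= action b - action a.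
Proof.
move=> a0 ab; have [w /andP[aw wb] ->] := action_MVT ab.
by rewrite [leRHS]mulrC ler_wpM2l ?subr_ge0// slope_nonincreasing//; lra.
Qed.

(** On [u, 1] the slope is at most (lambda (1 - u))^(p - 1). *)
Lemma action_tail u : 0 <= u -> u <= 1 ->
  action 1 - action u <= lambda_ p `^ (p - 1) * (1 - u) `^ p.
Proof.
move=> u0 u1; apply: le_trans (action_increment_le u0 u1) _.
have l0 := lambda_gt0 p1.
have pm0 : 0 < p - 1 by rewrite subr_gt0.
have u1' : 0 <= 1 - u by lra.
rewrite -(@mulr_powRB1 _ (1 - u) p)//; last by rewrite (lt_trans _ p1).
rewrite [leRHS]mulrCA ler_wpM2l// -powRM//; last exact: ltW.
apply: ge0_ler_powR; rewrite ?nnegrE ?(ltW pm0)//.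
- by rewrite /pos_part le_max lexx orbT.
- by rewrite mulr_ge0// ltW.
have h := mulr_ge0 (mulr_ge0 (ltW l0) u1') u1'.
by rewrite /pos_part ge_max mulr_ge0 ?(ltW l0)// andbT; lra.
Qed.

(** The action is concave on [0, 1], and u is at least as far from 3/4 as from 1.
    Hence leaving [u, 1] through 3/4 costs more than completing the transition. *)
Lemma action_dip u : 7 / 8 <= u ->
  action 1 - action u <= action u - action (3 / 4).
Proof.
move=> u78; have [u1|u1] := leP u 1; last first.
  have h1 := action_nondecreasing (ltW u1).
  have h2 : action (3 / 4) <= action u by apply: action_nondecreasing; lra.
  by lra.
have h1 : action 1 - action u <= (1 - u) * slope p u.
  by apply: action_increment_le => //; lra.
have h2 : (u - 3 / 4) * slope p u <= action u - action (3 / 4).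
  by apply: action_increment_ge; lra.
by have := slope_ge0 p u; nra.
Qed.

End Action.

(** * Energy of half a window *)

Section HalfWindow.
Context {R : realType}.
Local Notation mu := (@lebesgue_measure R).
Variable p : R.
Hypothesis p1 : 1 < p.
Variables (eps : R) (U g : R -> R).
Hypotheses (eps0 : 0 < eps) (Ug : controlled_by U g).
Implicit Types (s e x y t : R).

Local Notation L := (fun t => (density p eps (g t) (U t))%:E).

Lemma measurable_density (D : set (measurableTypeR R)) (f w : R -> R) :
  measurable_fun D f -> measurable_fun D w ->
  measurable_fun D (fun t => (density p eps (f t) (w t))%:E).
Proof.
move=> mf mw; apply/measurable_EFinP; apply: measurable_funD.
  apply: measurable_funM => //; apply: measurable_funM => //.
  have mnf : measurable_fun D (fun t => `|f t|) by exact: measurableT_comp.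
  exact: (measurableT_comp (measurable_powR p) mnf).
apply: measurable_funM => //; apply: measurable_funM => //.
have mw2 : measurable_fun D (fun t => `|w t ^+ 2 - 1|).
  apply: measurableT_comp => //; apply: measurable_funB => //.
  exact: measurable_funX.
exact: (measurableT_comp (measurable_powR p) mw2).
Qed.

Let mU : measurable_fun setT U.
Proof. by apply: continuous_measurable_fun; case: Ug. Qed.

Let mg : measurable_fun setT g.
Proof. by case: Ug => _ /integrableP[/measurable_EFinP]. Qed.

Lemma measurable_density_pair (D : set (measurableTypeR R)) : measurable_fun D L.
Proof. by apply: measurable_density; exact: measurable_funTS. Qed.

(** Integrate the pointwise bound, using [chain_inequality] between x and y only,
    while the constant k is collected over the whole of [s, e]. *)
Lemma calibration s e x y (Psi psi : R -> R) (k : R) :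
  0 <= k -> x \in `[s, e] -> y \in `[s, e] ->
  (forall t, t \in `[s, e] -> [/\ is_derive (U t) (1:R) Psi (psi (U t)),
     {for U t, continuous psi}, 0 <= psi (U t) &
     forall q, psi (U t) * `|q| + k <= density p eps q (U t)]) ->
  ((`|Psi (U y) - Psi (U x)| + k * (e - s))%:E <= \int[mu]_(t in `[s, e]) L t)%E.
Proof.
move=> k0; wlog xy : x y / x <= y.
  move=> W xse yse H; case: (leP x y) => [xy|/ltW yx]; first exact: W.
  by rewrite distrC; exact: W.
move=> xse yse H.
have se : s <= e by move: xse; rewrite in_itv/= => /andP[]; exact: le_trans.
have sub t : t \in `[x, y] -> t \in `[s, e].
  by move: xse yse; rewrite !in_itv/= => /andP[? ?] /andP[? ?] /andP[? ?]; lra.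
have mpsi : measurable_fun `[s, e] (fun t => (psi (U t) * `|g t|)%:E).
  apply/measurable_EFinP; apply: measurable_funM.
    apply: (@measurable_comp_controlled _ U g psi s e Ug).
    by move=> t /H[].
  by apply: measurableT_comp => //; exact: measurable_funTS.
have psi0 t : t \in `[s, e] -> (0 <= (psi (U t) * `|g t|)%:E)%E.
  by move=> /H[_ _ h _]; rewrite lee_fin mulr_ge0.
apply: (@le_trans _ _ (\int[mu]_(t in `[s, e]) ((psi (U t) * `|g t|)%:E + k%:E))%E).
  rewrite ge0_integralD//= integral_cst//= lebesgue_measure_itv/= lte_fin EFinD.
  apply: leeD; last first.
    case: ifPn; first by rewrite -EFinD -EFinM.
    by rewrite -leNgt => es; rewrite mule0 lee_fin; apply: mulr_ge0_le0; lra.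
  have := @chain_inequality _ U g Psi psi x y Ug xy _ _.
  move=> /(_ _ _)/le_trans; apply.
  - by move=> t /sub/H[].
  - by move=> t /sub/H[].
  rewrite (@eq_integral _ _ _ mu `[x, y] (fun t => (psi (U t) * `|g t|)%:E)); last first.
    by move=> t; rewrite inE/= => /sub/H[_ _ h _]; rewrite ger0_norm.
  by apply: ge0_subset_integral => // t /sub.
apply: ge0_le_integral => //.
- by move=> t tse; rewrite adde_ge0// psi0.
- by apply: emeasurable_funD => //; exact: measurable_cst.
- exact: measurable_density_pair.
- by move=> t /H[_ _ _ h]; rewrite -EFinD lee_fin.
Qed.

Lemma variation_bound s e x y : x \in `[s, e] -> y \in `[s, e] ->
  ((action p (U y) - action p (U x))%:E <= \int[mu]_(t in `[s, e]) L t)%E.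
Proof.
move=> xse yse.
apply: (@le_trans _ _ (`|action p (U y) - action p (U x)| + 0 * (e - s))%:E).
  by rewrite lee_fin mul0r addr0 ler_norm.
apply: (@calibration s e x y (action p) (slope p) 0) => // t _; split.
- exact: is_derive_action.
- exact: continuous_slope.
- exact: slope_ge0.
- by move=> q; rewrite addr0 density_ge_slope.
Qed.

Lemma is_derive_barrier (kappa w : R) : w < 1 ->
  is_derive w (1:R) (fun v => action p v + kappa * ln (1 - v))
    (slope p w - kappa / (1 - w)).
Proof.
move=> w1.
have h1 := is_derive_action p1 w.
have w0 : 0 < 1 - w by lra.
have h0 : is_derive w (1:R) (fun v : R => 1 - v) (-1).
  by have := is_deriveB (is_derive_cst (1:R) w (1:R)) (is_derive_id w (1:R)); rewrite sub0r.
have h2 : is_derive w (1:R) (@ln R \o (fun v : R => 1 - v)) ((1 - w)^-1 * -1).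
  exact: (@is_derive1_comp R (@ln R) (fun v : R => 1 - v) w _ _ (is_derive1_ln w0) h0).
have h3 : is_derive w (1:R) (kappa *: (@ln R \o (fun v : R => 1 - v))) (kappa *: ((1 - w)^-1 * -1)).
  exact: is_deriveZ.
have := is_deriveD h1 h3.
by rewrite /GRing.scale/= mulrA mulrN1.
Qed.

Lemma continuous_barrier_slope (kappa w : R) : w < 1 ->
  {for w, continuous (fun v => slope p v - kappa / (1 - v))}.
Proof.
move=> w1; apply: cvgB; first exact: continuous_slope.
apply: cvgM; first exact: cvg_cst.
apply: cvgV; first by rewrite subr_eq0 gt_eqF.
by apply: cvgB => //; exact: cvg_cst.
Qed.

(** If U comes within m = exp (- A / (2 eps)) of 1, at most the action of
    [1 - m, 1] is missing.  If U dips below 3/4, [action_dip] suffices.  Otherwise U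
    stays in [3/4, 1 - z], where z > m is its least distance from 1, and the energy
    is calibrated by action u + kappa ln (1 - u) with kappa = barrier_coef z^p.
    The logarithm costs at most kappa A / (2 eps), and the potential freed during
    the time e - s repays it together with the missing action
    lambda^(p-1) z^p. *)
Lemma half_window s e x (A : R) : x \in `[s, e] -> 7 / 8 <= U x ->
  lambda_ p `^ (p - 1) + barrier_coef p * (A / (2 * eps)) <=
    105 / 128 * barrier_coef p * lambda_ p * (e - s) / eps ->
  ((action p 1 - action p (U x)
    - lambda_ p `^ (p - 1) * expR (- (A * p / (2 * eps))))%:E
   <= \int[mu]_(t in `[s, e]) L t)%E.
Proof.
move=> xse Ux long.
have p0 : 0 < p by rewrite (lt_trans _ p1).
have se : s <= e by move: xse; rewrite in_itv/= => /andP[]; exact: le_trans.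
have l0 := lambda_gt0 p1.
have C0 : 0 < lambda_ p `^ (p - 1) by rewrite powR_gt0.
have cU : continuous U by case: Ug.
have [y yse ymax] := EVT_max se (continuous_subspaceT cU).
have Uxy : U x <= U y by exact: ymax.
set m := expR (- (A / (2 * eps))).
have m0 : 0 < m by rewrite expR_gt0.
have -> : expR (- (A * p / (2 * eps))) = m `^ p.
  by rewrite /m -expRM; congr expR; field; rewrite gt_eqF.
have mp0 : 0 < m `^ p by rewrite powR_gt0.
have Cm0 : 0 < lambda_ p `^ (p - 1) * m `^ p by rewrite mulr_gt0.
(* Beyond 1 no action is missing; within m of 1, at most that of [1 - m, 1] is. *)
have [near1|far] := leP (1 - m) (U y).
  apply: le_trans (variation_bound xse yse); rewrite lee_fin.
  have [Uy1|/ltW Uy1] := leP (U y) 1; last first.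
    by have := action_nondecreasing p1 Uy1; lra.
  have Uy0 : 0 <= U y by lra.
  have := action_tail p1 Uy0 Uy1.
  have : (1 - U y) `^ p <= m `^ p.
    by apply: ge0_ler_powR; rewrite ?nnegrE ?(ltW p0) ?(ltW m0) ?subr_ge0//; lra.
  by rewrite -(ler_pM2l C0); lra.
have [[t [tse Ut]]|nodip] := pselect (exists t, (t \in `[s, e]) /\ U t < 3 / 4).
  apply: le_trans (variation_bound tse xse); rewrite lee_fin.
  have := action_dip p1 Ux.
  by have := action_nondecreasing p1 (ltW Ut); lra.
have U34 t : t \in `[s, e] -> 3 / 4 <= U t.
  by move=> tse; rewrite leNgt; apply/negP => h; apply: nodip; exists t.
(* From here on u stays in [3/4, 1 - z] with z > m, where the barrier applies. *)
pose z := 1 - U y; pose kappa := barrier_coef p * z `^ p.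
have b0 := barrier_coef_gt0 p1.
have zm : m < z by rewrite /z ltrBrDr -ltrBrDl.
have z0 : 0 < z by exact: lt_trans zm.
have zp0 : 0 < z `^ p by rewrite powR_gt0.
have kappa0 : 0 <= kappa by rewrite ltW// mulr_gt0.
pose k := 105 / 128 * kappa * lambda_ p / eps.
have k0 : 0 <= k.
  rewrite /k; apply: divr_ge0; last exact: ltW.
  by apply: mulr_ge0; [apply: mulr_ge0 => //; apply: divr_ge0|exact: ltW].
have yz : U y = 1 - z by rewrite /z subKr.
have cal := @calibration s e x y (fun v => action p v + kappa * ln (1 - v))
  (fun v => slope p v - kappa / (1 - v)) k k0 xse yse.
apply: le_trans (cal _); last first.
  move=> t tse; have Ut1 : U t <= 1 - z by rewrite -yz ymax.
  have Utlt1 : U t < 1 by apply: le_lt_trans Ut1 _; rewrite gtrBl.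
  split.
  - exact: is_derive_barrier.
  - exact: continuous_barrier_slope.
  - exact: (barrier_slope_ge0 p1 z0 (U34 _ tse) Ut1 erefl erefl erefl).
  - by move=> q; exact: (barrier_density p1 z0 (U34 _ tse) Ut1 erefl erefl erefl).
rewrite lee_fin.
have Uy0 : 0 <= U y by lra.
have Uy1 : U y <= 1 by rewrite yz gerBl ltW.
have tail := action_tail p1 Uy0 Uy1; rewrite -/z in tail.
apply: le_trans (lerD (ler_norm _) (lexx _)).
rewrite -/z.
have lnx : ln (1 - U x) <= 0 by apply: ln_le0; lra.
have lnz : - (A / (2 * eps)) <= ln z.
  by rewrite -(expRK (- (A / (2 * eps)))) ler_ln ?posrE// ltW.
have hk : kappa * (ln z - ln (1 - U x)) >= kappa * - (A / (2 * eps)).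
  by rewrite ler_wpM2l//; lra.
have fin : z `^ p * (lambda_ p `^ (p - 1) + barrier_coef p * (A / (2 * eps))) <=
   k * (e - s).
  have -> : k * (e - s) = z `^ p * (105 / 128 * barrier_coef p * lambda_ p * (e - s) / eps).
    by rewrite /k /kappa; field; rewrite gt_eqF.
  by rewrite ler_pM2l.
have -> : k * (e - s) = k * (e - s) - z `^ p * (lambda_ p `^ (p - 1) + barrier_coef p * (A / (2 * eps)))
  + lambda_ p `^ (p - 1) * z `^ p + kappa * (A / (2 * eps)).
  by rewrite /kappa; ring.
lra.
Qed.

End HalfWindow.

(** * Energy of one transition *)

Section Window.
Context {R : realType}.
Local Notation mu := (@lebesgue_measure R).
Implicit Types (u v g U : R -> R) (s e x y t : R).

Lemma densityN (p eps q w : R) : density p eps q (- w) = density p eps q w.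
Proof. by rewrite /density /potential sqrrN. Qed.

(** Split at x and y.  The middle part pays for action (U y) - action (U x), the
    right part for what is missing from U y to 1, and the left part, by the symmetry
    u -> -u, for what is missing from -1 to U x. *)
Lemma transition_energy (p eps A l : R) U g s x y e :
  1 < p -> 0 < eps -> controlled_by U g ->
  s <= x -> x <= y -> y <= e -> l <= x - s -> l <= e - y ->
  U x <= - (7 / 8) -> 7 / 8 <= U y ->
  lambda_ p `^ (p - 1) + barrier_coef p * (A / (2 * eps)) <=
    105 / 128 * barrier_coef p * lambda_ p * l / eps ->
  ((c_ p - 2 * (lambda_ p `^ (p - 1) * expR (- (A * p / (2 * eps)))))%:E
   <= \int[mu]_(t in `[s, e]) (density p eps (g t) (U t))%:E)%E.
Proof.
move=> p1 eps0 Ug sx xy ye ls le Ux Uy long.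
have mL D := measurable_density_pair p eps Ug D.
have L0 t : (0 <= (density p eps (g t) (U t))%:E)%E by rewrite lee_fin density_ge0.
have longer l' : l <= l' -> lambda_ p `^ (p - 1) + barrier_coef p * (A / (2 * eps)) <=
    105 / 128 * barrier_coef p * lambda_ p * l' / eps.
  move=> ll'; apply: le_trans long _; rewrite ler_pM2r ?invr_gt0//.
  rewrite ler_pM2l// mulr_gt0 ?lambda_gt0// mulr_gt0 ?barrier_coef_gt0// divr_gt0//.
rewrite (ge0_integral_split sx (le_trans xy ye) (mL _) (fun t _ => L0 t)).
rewrite (ge0_integral_split xy ye (mL _) (fun t _ => L0 t)).
have yye : y \in `[y, e] by rewrite in_itv/= lexx.
have xsx : x \in `[s, x] by rewrite in_itv/= lexx andbT.
have right := half_window p1 eps0 Ug yye Uy (longer _ le).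
have left : ((action p 1 - action p (- U x)
    - lambda_ p `^ (p - 1) * expR (- (A * p / (2 * eps))))%:E
   <= \int[mu]_(t in `[s, x]) (density p eps (g t) (U t))%:E)%E.
  have NUx : 7 / 8 <= - U x by lra.
  apply: le_trans (half_window p1 eps0 (controlled_byN Ug) xsx NUx (longer _ ls)) _.
  by under eq_integral do rewrite densityN.
have middle : ((action p (U y) - action p (U x))%:E
   <= \int[mu]_(t in `[x, y]) (density p eps (g t) (U t))%:E)%E.
  by apply: (variation_bound p1 eps0 Ug); rewrite in_itv/= lexx ?xy.
apply: le_trans (leeD left (leeD middle right)).
rewrite -!EFinD lee_fin -(actionN p1 (U x)).
have := action1 p1; rewrite -(actionN p1 (U x)).
by lra.
Qed.

(** Off the finitely many jumps v is locally constant, hence continuous. *)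
Lemma measurable_piecewise_constant a b N (h : 'I_N -> R) v :
  piecewise_constant_with_jumps a b h v -> measurable_fun `]a, b[ v.
Proof.
move=> [v1 hab _ vc _].
pose H := [set` [seq h i | i <- enum 'I_N]].
have fH : finite_set H by exact: finite_seq.
have fC (B : set R) : finite_set B -> closed B.
  by move=> fB; apply: compact_closed; [exact: Rhausdorff|exact: finite_compact].
pose O := `]a, b[ `\` H.
have oO : open O by apply: openI; [exact: itv_open|apply: closed_openC; exact: fC].
have cv : {in O, continuous v}.
  move=> x; rewrite inE => Ox.
  have [e /= e0 eO] := (nbhs_ballP _ _).1 (open_nbhs_nbhs (conj oO Ox)).
  apply: cvg_near_cst.
  apply/nbhs_ballP; exists e => //= y xy.
  have inO z : Num.min x y <= z <= Num.max x y -> O z.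
    move=> zxy; apply: eO; move: xy zxy; rewrite /ball/=.
    by case: (leP x y) => ?; rewrite !ltr_norml => /andP[? ?] /andP[? ?]; apply/andP; split; lra.
  have itvO z : O z -> a < z < b by move=> []; rewrite /= in_itv.
  have noh z i : O z -> h i <> z.
    move=> [_ nH] hz; apply: nH; rewrite /H/= -hz; apply/mapP; exists i => //.
    by rewrite mem_enum.
  have /itvO xab : O x by [].
  have /itvO yab : O y by apply: inO; case: (leP x y) => ?; apply/andP; split; lra.
  case: (leP x y) => xy'.
    apply/esym; apply: vc => //; try lra.
    by move=> i; apply/negP => hi; apply: (noh (h i) i) => //; apply: inO; rewrite min_l// max_r.
  apply: vc; try lra.
  by move=> i; apply/negP => hi; apply: (noh (h i) i) => //; apply: inO; rewrite min_r ?max_l// ltW.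
have -> : `]a, b[%classic = O `|` (`]a, b[ `&` H) by rewrite setUC setUIDK.
have fI : finite_set (`]a, b[ `&` H) by apply: sub_finite_set fH => z [].
apply/measurable_funU.
- exact: open_measurable.
- by apply: closed_measurable; exact: fC.
split; first exact: open_continuous_measurable_fun.
move=> _ B _; apply: closed_measurable; apply: fC.
by apply: sub_finite_set fI => z [].
Qed.

End Window.

Section Windows.
Context {R : realType}.
Local Notation mu := (@lebesgue_measure R).
Implicit Types (u v g U : R -> R) (s e x y t : R).

(** Otherwise |u - v| > eta almost everywhere on ]s, t[, so that the distance is at
    least eta (t - s). *)
Lemma L1_close_point u v U (sg a b s t delta eta : R) :
  measurable_fun `]a, b[ u -> measurable_fun `]a, b[ v ->
  (L1_distance a b u v <= delta%:E)%E ->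
  a <= s -> s < t -> t <= b -> 0 <= eta -> delta < eta * (t - s) ->
  {ae mu, forall x, x \in `]s, t[ -> U x = u x} ->
  (forall x, s < x -> x < t -> v x = sg) ->
  measurable_fun setT U ->
  exists2 x, s < x < t & `|U x - sg| <= eta.
Proof.
move=> mfu mv uv sa st tb eta0 small Uu vsg mU.
apply: contrapT => none.
have far x : s < x < t -> eta <= `|U x - sg|.
  by move=> xst; rewrite leNgt; apply/negP => /ltW h; apply: none; exists x.
have sub : `]s, t[ `<=` `]a, b[ by apply: subset_itv; rewrite bnd_simp.
suff : ((eta * (t - s))%:E <= delta%:E)%E by rewrite lee_fin leNgt small.
apply: le_trans uv.
apply: (@le_trans _ _ (\int[mu]_(x in `]s, t[) `|u x - v x|%:E)%E); last first.
  apply: ge0_subset_integral => //.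
  apply/measurable_EFinP; apply: measurableT_comp => //.
  exact: measurable_funB.
have mus : measurable_fun `]s, t[ (fun x => `|u x - v x|%:E).
  apply/measurable_EFinP; apply: measurableT_comp => //.
  by apply: measurable_funB; [exact: measurable_funS mfu|exact: measurable_funS mv].
have mUs : measurable_fun `]s, t[ (fun x => `|U x - sg|%:E).
  apply/measurable_EFinP; apply: measurableT_comp => //.
  by apply: measurable_funB => //; exact: measurable_funTS.
rewrite (@ge0_ae_eq_integral _ _ _ mu _ _ (fun x => `|U x - sg|%:E))//; last first.
  move: Uu; apply: filterS; first exact: (ae_filter_ringOfSetsType mu).
  move=> x h; rewrite /= in_itv/= => /andP[sx xt]; rewrite vsg// h// in_itv/= sx.
  exact: xt.
apply: (@le_trans _ _ (\int[mu]_(x in `]s, t[) eta%:E)%E).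
  by rewrite integral_cst//= lebesgue_measure_itv/= lte_fin st EFinM EFinB.
apply: ge0_le_integral => //.
Qed.

Section jumps.
Variables (a b r : R) (N : nat) (h : 'I_N -> R) (v : R -> R).
Hypotheses (hv : piecewise_constant_with_jumps a b h v) (r0 : 0 < r).
Hypothesis hsep : forall i j : 'I_N, j = i.+1 :> nat -> h i + r < h j - r.
Hypothesis hfirst : forall i : 'I_N, i = 0%N :> nat -> a <= h i - r.
Hypothesis hlast : forall i : 'I_N, i.+1 = N -> h i + r <= b.

Lemma jumps_separated (i j : 'I_N) : (i < j)%N -> h i + r < h j - r.
Proof.
move=> ij; have iN : (i.+1 < N)%N by exact: leq_ltn_trans ij (ltn_ord j).
have := hsep (i := i) (j := Ordinal iN) erefl.
have [_ _ hinc _ _] := hv.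
move: ij; rewrite leq_eqVlt => /orP[/eqP ij|ij].
  by rewrite (_ : Ordinal iN = j)//; apply: val_inj.
by have := hinc (Ordinal iN) j ij; lra.
Qed.

Lemma window_left (i : 'I_N) : a <= h i - r.
Proof.
have [i0|i0] := posnP i; first exact: hfirst.
have iN : (i.-1 < N)%N by apply: leq_ltn_trans (ltn_ord i); exact: leq_pred.
have := hsep (i := Ordinal iN) (j := i); rewrite /= prednK// => /(_ erefl).
by have [_ hab _ _ _] := hv; have /andP[] := hab (Ordinal iN); move: r0; lra.
Qed.

Lemma window_right (i : 'I_N) : h i + r <= b.
Proof.
have [iN|iN] := ltnP i.+1 N; last first.
  by apply: hlast; apply/eqP; rewrite eqn_leq iN ltn_ord.
have := hsep (i := i) (j := Ordinal iN) erefl.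
by have [_ hab _ _ _] := hv; have /andP[] := hab (Ordinal iN); move: r0; lra.
Qed.

Lemma no_other_jump (i j : 'I_N) x : h i - r < x -> x < h i + r -> h j = x -> j = i.
Proof.
move=> xl xr hj; apply: val_inj; apply/eqP; rewrite eqn_leq; apply/andP; split.
  by rewrite leqNgt; apply/negP => /jumps_separated; move: r0; lra.
by rewrite leqNgt; apply/negP => /jumps_separated; move: r0; lra.
Qed.

(** v is constant on each side of the jump, because the other jumps are at distance
    more than 2 r; the two constants differ since the one-sided limits do. *)
Lemma jump_sign (i : 'I_N) : exists2 sg : R, sg = 1 \/ sg = -1 &
  (forall x, h i - r < x -> x < h i -> v x = - sg) /\
  (forall x, h i < x -> x < h i + r -> v x = sg).
Proof.
have [v1 hab hinc vc jump] := hv.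
have wl := window_left i. have wr := window_right i.
have cl x y : h i - r < x -> x <= y -> y < h i -> v x = v y.
  move=> hx xy yh; apply: vc => //.
  - by move: r0; lra.
  - by move: r0; lra.
  move=> j; apply/negP => /andP[xj jy].
  have ji : j = i by apply: (@no_other_jump i j (h j)) => //; move: r0; lra.
  by move: jy; rewrite ji; lra.
have cr x y : h i < x -> x <= y -> y < h i + r -> v x = v y.
  move=> hx xy yh; apply: vc => //.
  - by move: r0; lra.
  - by move: r0; lra.
  move=> j; apply/negP => /andP[xj jy].
  have ji : j = i by apply: (@no_other_jump i j (h j)) => //; move: r0; lra.
  by move: xj; rewrite ji; lra.
pose L := v (h i - r / 2); pose W := v (h i + r / 2).
have lL x : h i - r < x -> x < h i -> v x = L.
  move=> ? ?; case: (leP x (h i - r / 2)) => ?; rewrite /L.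
    by apply: cl => //; move: r0; lra.
  by apply/esym; apply: cl => //; move: r0; lra.
have lW x : h i < x -> x < h i + r -> v x = W.
  move=> ? ?; case: (leP x (h i + r / 2)) => ?; rewrite /W.
    by apply: cr => //; move: r0; lra.
  by apply/esym; apply: cr => //; move: r0; lra.
have LW : L <> W.
  have [l [s [vl vs ls]]] := jump i.
  have vL : v x @[x --> (h i)^'-] --> L.
    apply: cvg_near_cst; near=> x; apply: lL; near: x.
      by apply: nbhs_left_gt; move: r0; lra.
    by apply: nbhs_left_lt.
  have vW : v x @[x --> (h i)^'+] --> W.
    apply: cvg_near_cst; near=> x; apply: lW; near: x.
      by apply: nbhs_right_gt.
    by apply: nbhs_right_lt; move: r0; lra.
  have <- : l = L by rewrite -(cvg_lim (@Rhausdorff R) vl) (cvg_lim (@Rhausdorff R) vL).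
  by have <- : s = W by rewrite -(cvg_lim (@Rhausdorff R) vs) (cvg_lim (@Rhausdorff R) vW).
have L1 : L = -1 \/ L = 1.
  by apply: v1; rewrite in_itv/=; apply/andP; split; move: r0 wl wr; lra.
have W1 : W = -1 \/ W = 1.
  by apply: v1; rewrite in_itv/=; apply/andP; split; move: r0 wl wr; lra.
exists W; first by case: W1; [right|left].
split=> // x xl xr; rewrite lL//.
by case: L1 W1 LW => -> [] -> //; rewrite opprK.
Unshelve. all: by end_near. Qed.

End jumps.

(** Such an L1 distance is less than 1/8 * (r / 16), which forces u to be within 1/8
    of each well at some point at distance less than r / 16 from c, on the
    corresponding side.  These points leave more than 7/8 * r of the segment of
    radius 15/16 * r on each side.  The slightly larger segment of radius 31/32 * r
    is where u is replaced by its continuous representative. *)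
Lemma window_energy (p a b c r eps A : R) u g v (sg : R) :
  1 < p -> 0 < r -> a <= c - r -> c + r <= b -> 0 < eps ->
  measurable_fun `]a, b[ u -> measurable_fun `]a, b[ v ->
  is_weak_derivative a b u g ->
  sg = 1 \/ sg = -1 ->
  (forall x, c - r < x -> x < c -> v x = - sg) ->
  (forall x, c < x -> x < c + r -> v x = sg) ->
  (L1_distance a b u v <= (r / 16 / 16)%:E)%E ->
  lambda_ p `^ (p - 1) + barrier_coef p * (A / (2 * eps)) <=
    105 / 128 * barrier_coef p * lambda_ p * (7 / 8 * r) / eps ->
  ((c_ p - 2 * (lambda_ p `^ (p - 1) * expR (- (A * p / (2 * eps)))))%:E
   <= \int[mu]_(t in `[(c - 15 / 16 * r)%R, (c + 15 / 16 * r)%R])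
        (density p eps (g t) (u t))%:E)%E.
Proof.
move=> p1 r0 ca cb eps0 mfu mv wug sg1 vl vr uv.
have ac : a < c - 31 / 32 * r by lra.
have cb' : c + 31 / 32 * r < b by lra.
have [U Ug Uu] := weak_derivative_representative wug ac cb'.
have mU : measurable_fun setT U by apply: continuous_measurable_fun; case: Ug.
have Uu' s t : c - 31 / 32 * r <= s -> t <= c + 31 / 32 * r ->
    {ae mu, forall x, x \in `]s, t[ -> U x = u x}.
  move=> h1 h2; move: Uu; apply: filterS; first exact: (ae_filter_ringOfSetsType mu).
  move=> x Ux xst; apply: Ux; move: xst h1 h2; rewrite !in_itv/=; clear.
  by move=> /andP[? ?] ? ?; apply/andP; split; lra.
have [y /andP[cy yr] Uy] : exists2 y, c < y < c + r / 16 & `|U y - sg| <= 1 / 8.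
  apply: (L1_close_point mfu mv uv) => //.
  - by move: ca r0; clear; lra.
  - by move: r0; clear; lra.
  - by move: cb r0; clear; lra.
  - by move: r0; clear; lra.
  - by apply: Uu'; move: r0; clear; lra.
  - by move=> x cx xr; apply: vr => //; move: xr r0; clear; lra.
have [x /andP[rx xc] Ux] : exists2 x, c - r / 16 < x < c & `|U x - - sg| <= 1 / 8.
  apply: (L1_close_point mfu mv uv) => //.
  - by move: ca r0; clear; lra.
  - by move: r0; clear; lra.
  - by move: cb r0; clear; lra.
  - by move: r0; clear; lra.
  - by apply: Uu'; move: r0; clear; lra.
  - by move=> z rz zc; apply: vl => //; move: rz r0; clear; lra.
pose G := g \_ `[c - 31 / 32 * r, c + 31 / 32 * r].
have -> : (\int[mu]_(t in `[(c - 15 / 16 * r)%R, (c + 15 / 16 * r)%R])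
        (density p eps (g t) (u t))%:E =
   \int[mu]_(t in `[(c - 15 / 16 * r)%R, (c + 15 / 16 * r)%R])
        (density p eps (G t) (U t))%:E)%E.
  have [lu lg _] := wug.
  have sub : `[(c - 15 / 16 * r)%R, (c + 15 / 16 * r)%R] `<=` `]a, b[.
    by apply: subset_itv; rewrite bnd_simp; move: ca cb r0; clear; lra.
  apply: ge0_ae_eq_integral => //.
  - apply: measurable_density; first by apply: measurable_funS sub _ => //; case: lg.
    exact: measurable_funS sub _.
  - exact: measurable_density_pair.
  - by move=> t _; rewrite lee_fin density_ge0.
  - by move=> t _; rewrite lee_fin density_ge0.
  move: Uu; apply: filterS; first exact: (ae_filter_ringOfSetsType mu).
  move=> t Ut; rewrite /= in_itv/= => /andP[tl tr].
  have tin : c - 31 / 32 * r < t < c + 31 / 32 * r.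
    by move: tl tr r0; clear => *; apply/andP; split; lra.
  rewrite Ut ?in_itv//= /G patchE mem_setE in_itv/= ifT//.
  by move: tin; clear => /andP[? ?]; apply/andP; split; exact: ltW.
move: Ux Uy; rewrite !ler_norml => /andP[Ux1 Ux2] /andP[Uy1 Uy2].
(* If v jumps down, - U makes the same transition upwards. *)
case: sg1 => sgE; rewrite {}sgE in Ux1 Ux2 Uy1 Uy2.
  by move=> long; apply: (@transition_energy _ p eps A (7 / 8 * r) U G _ x y) => //;
    move: rx xc cy yr Ux1 Ux2 Uy1 Uy2 r0; clear; lra.
have Ng := controlled_byN Ug.
move=> long; under eq_integral do rewrite -densityN.
by apply: (@transition_energy _ p eps A (7 / 8 * r) (fun t => - U t) G _ x y) => //;
  move: rx xc cy yr Ux1 Ux2 Uy1 Uy2 r0; clear; lra.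
Qed.

End Windows.

(** * Sum over the jumps *)

Lemma integral_ge_disjoint (d : measure_display) (T : measurableType d) (R : realType)
    (m : {measure set T -> \bar R}) (N : nat) (F : 'I_N -> set T) (D : set T)
    (f : T -> \bar R) (k : R) :
  measurable D -> (forall i, measurable (F i)) -> trivIset setT F ->
  (forall i, F i `<=` D) -> measurable_fun D f -> (forall x, D x -> (0 <= f x)%E) ->
  (forall i, (k%:E <= \int[m]_(x in F i) f x)%E) ->
  ((N%:R * k)%:E <= \int[m]_(x in D) f x)%E.
Proof.
move=> mD mF tF FD mf f0 kF.
have UE : \big[setU/set0]_(i <- enum 'I_N) F i = \bigcup_(i in [set` enum 'I_N]) F i.
  by rewrite bigcup_seq.
have UD : \big[setU/set0]_(i <- enum 'I_N) F i `<=` D.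
  by rewrite UE => x [i _ /FD].
have mU : measurable (\big[setU/set0]_(i <- enum 'I_N) F i).
  by apply: bigsetU_measurable.
apply: (@le_trans _ _ (\int[m]_(x in \big[setU/set0]_(i <- enum 'I_N) F i) f x)%E); last first.
  exact: ge0_subset_integral.
rewrite ge0_integral_bigsetU//; last 4 first.
- exact: enum_uniq.
- by apply: sub_trivIset tF.
- exact: measurable_funS UD mf.
- by move=> x /UD/f0.
apply: (@le_trans _ _ (\sum_(i <- enum 'I_N) k%:E)%E); last first.
  by apply: lee_sum => i _; exact: kF.
rewrite sumEFin lee_fin big_enum/= sumr_const card_ord mulr_natl lexx//.
Qed.

Theorem proposition2 (R : realType) (a b p : R) (hab : a < b) (hp : 1 < p)
    (N : nat) (h : 'I_N -> R) (v : R -> R)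
    (hv : piecewise_constant_with_jumps a b h v)
    (r : R) (hr : 0 < r)
    (hsep : forall i j : 'I_N, j = i.+1 :> nat -> h i + r < h j - r)
    (hfirst : forall i : 'I_N, i = 0%N :> nat -> a <= h i - r)
    (hlast : forall i : 'I_N, i.+1 = N -> h i + r <= b)
    (A : R) (hA0 : 0 < A) (hA : A < r * Num.sqrt 2 * lambda_ p) :
  exists eps0 C delta : R,
    [/\ 0 < eps0, 0 < C, 0 < delta &
      forall u : R -> R, H1 a b u ->
        (L1_distance a b u v <= delta%:E)%E ->
        forall eps : R, 0 < eps < eps0 ->
          ((N%:R * c_ p - C * expR (- (A * p / (2 * eps))))%:E
             <= energy p a b eps u)%E].
Proof.
have l0 := lambda_gt0 hp.
have b0 := barrier_coef_gt0 hp.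
pose K := lambda_ p `^ (p - 1).
have K0 : 0 < K by rewrite powR_gt0.
(* The least rescaled gain of a half window, minus the logarithmic loss. *)
pose gap := 105 / 128 * (7 / 8) * lambda_ p * r - A / 2.
have gap0 : 0 < gap.
  (* 10/7 exceeds sqrt 2, and its half 5/7 is below 105/128 * 7/8. *)
  have s0 : 0 <= Num.sqrt 2 :> R by exact: sqrtr_ge0.
  have s2 : Num.sqrt 2 ^+ 2 = 2 :> R by rewrite sqr_sqrtr.
  have s107 : Num.sqrt 2 <= 10 / 7 :> R by nra.
  have rl0 : 0 < r * lambda_ p by rewrite mulr_gt0.
  have : A < 10 / 7 * (r * lambda_ p).
    apply: lt_le_trans hA _; rewrite mulrAC mulrC.
    by rewrite ler_pM2r.
  by rewrite /gap subr_gt0; move: rl0; clear; lra.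
exists (barrier_coef p * gap / K), (2 * K * N%:R + 1), (r / 16 / 16); split.
- by rewrite divr_gt0// mulr_gt0.
- by rewrite ltr_wpDl// !mulr_ge0// ltW.
- by rewrite !divr_gt0.
move=> u [[mfu _] [g0 _ wug0]] uv eps /andP[eps0 epslt].
pose g := weak_derivative a b u.
have wug : is_weak_derivative a b u g.
  exact: (@xgetPex _ (cst 0) [set g | is_weak_derivative a b u g] (ex_intro _ g0 wug0)).
have mfg : measurable_fun `]a, b[ g by case: wug => _ [].
have long : K + barrier_coef p * (A / (2 * eps)) <=
    105 / 128 * barrier_coef p * lambda_ p * (7 / 8 * r) / eps.
  have h1 : K <= barrier_coef p * gap / eps.
    by move: epslt; rewrite ltr_pdivlMr// ler_pdivlMr// mulrC => /ltW.
  apply: le_trans (lerD h1 (lexx _)) _.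
  rewrite le_eqVlt; apply/orP; left; apply/eqP.
  by rewrite /gap; field; rewrite gt_eqF.
have mv := measurable_piecewise_constant hv.
have wl := window_left hv hr hsep hfirst.
have wr := window_right hv hr hsep hlast.
have sep := jumps_separated hv hsep.
set m := expR _.
have win i : ((c_ p - 2 * (K * m))%:E
   <= \int[@lebesgue_measure R]_(t in `[(h i - 15 / 16 * r)%R, (h i + 15 / 16 * r)%R])
        (density p eps (g t) (u t))%:E)%E.
  have [sg sg1 [vl vr]] := jump_sign hv hr hsep hfirst hlast i.
  exact: (window_energy hp hr (wl i) (wr i) eps0 mfu mv wug sg1 vl vr uv long).
have := @integral_ge_disjoint _ _ R (@lebesgue_measure R) N
  (fun i => `[(h i - 15 / 16 * r)%R, (h i + 15 / 16 * r)%R]%classic) `]a, b[%classic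
  (fun t => (density p eps (g t) (u t))%:E) (c_ p - 2 * (K * m)).
move=> H; apply: le_trans (H _ _ _ _ _ _ _) => //.
- rewrite lee_fin mulrBr lerD2l lerN2 -subr_ge0.
  have -> : (2 * K * N%:R + 1) * m - N%:R * (2 * (K * m)) = m by ring.
  exact: expR_ge0.
- apply/trivIsetP => i j _ _; wlog ij : i j / (i < j)%N.
    move=> W ij; have [lij|lji|/val_inj E] := ltngtP i j.
    + exact: W.
    + by rewrite setIC; apply: W => //; rewrite eq_sym.
    + by rewrite E eqxx in ij.
  move=> _; rewrite -subset0 => x /=; rewrite !in_itv/= => -[/andP[_ xi] /andP[xj _]].
  by have := sep _ _ ij; move: hr xi xj; clear; lra.
- move=> i; apply: subset_itv; rewrite bnd_simp; [have := wl i|have := wr i]; move: hr; clear; lra.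
- exact: measurable_density.
- by move=> x _; rewrite lee_fin density_ge0.
Qed.
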